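(* Let $n\ge 1$, let $\boldsymbol\beta/\boldsymbol\gamma=(\beta^{(1)}/\gamma^{(1)},\beta^{(2)}/\gamma^{(2)})$ be a pair of skew partitions, and let $(\boldsymbol\beta/\boldsymbol\gamma)_{swap}=(\beta^{(2)}/\gamma^{(2)},\beta^{(1)}/\gamma^{(1)})$. If there is a unique non-crossing matching $M$ of the sequence of beads associated to $\boldsymbol\beta/\boldsymbol\gamma$, then the coinversion LLT polynomials $\mathcal L_{\boldsymbol\beta/\boldsymbol\gamma}(X_n;t)$ and $\mathcal L_{(\boldsymbol\beta/\boldsymbol\gamma)_{swap}}(X_n;t)$ are equivalent (equal up to an overall power of $t$). In particular, $$\mathcal L_{\boldsymbol\beta/\boldsymbol\gamma}(X_n;t)=\Big(\prod_{a\in M}w(a)\Big)\,\mathcal L_{(\boldsymbol\beta/\boldsymbol\gamma)_{swap}}(X_n;t),$$ where the product is over all arcs $a$ of $M$ and $w(a)$ is the weight of the arc.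
   Context: **Partitions.** A partition is a finite sequence $\lambda=(\lambda_1\ge\dots\ge\lambda_\ell\ge 0)$ with a fixed number $\ell$ of parts, zero parts allowed. Its cells are $(i,j)$ with $1\le i\le \ell$ (row), $1\le j\le\lambda_i$ (column). The content of a cell $(i,j)$ is $j-i$ (also for positions outside the diagram). In a skew partition $\beta/\gamma$, $\gamma$ has the same number of parts as $\beta$ (padded by zeros) and $\gamma_i\le\beta_i$; its cells are the cells of $\beta$ not in $\gamma$. A straight shape $\beta$ means $\beta/(0,\dots,0)$. A semistandard filling has positive integer entries weakly increasing in $j$ along rows and strictly increasing in $i$ along columns. **Coinversion LLT polynomial.** $\mathrm{SSYT}(\boldsymbol\beta/\boldsymbol\gamma)$ is the set of pairs $T=(T_1,T_2)$ of semistandard fillings of $\beta^{(1)}/\gamma^{(1)}$ and $\beta^{(2)}/\gamma^{(2)}$. A triple consists of a cell $v$ of $\beta^{(1)}/\gamma^{(1)}$ and two adjacent positions $u=(r,c)$, $w=(r,c+1)$ in a row $r$ (a row index of $\beta^{(2)}$, rows of length zero included) of the second shape, with $\gamma^{(2)}_r\le c\le \beta^{(2)}_r$, such that $v$ and $w$ have the same content. (So $u$ may be one position left of the start of the row, and $w$ may be one position right of its end.) Let $b$ be the entry of $v$, let $a$ be the entry of $u$ (with $a=0$ if $u$ is not a cell of $\beta^{(2)}/\gamma^{(2)}$), and let $c'$ be the entry of $w$ (with $c'=\infty$ if $w$ is not a cell of $\beta^{(2)}/\gamma^{(2)}$). The triple is a coinversion triple of $T$ if $a\le b\le c'$. Let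 $\mathrm{coinv}(T)$ be the number of coinversion triples. Then $\mathcal L_{\boldsymbol\beta/\boldsymbol\gamma}(X_n;t)=\sum_T t^{\mathrm{coinv}(T)}x^T$, summed over $T\in\mathrm{SSYT}(\boldsymbol\beta/\boldsymbol\gamma)$ with entries in $\{1,\dots,n\}$, where $x^T=\prod_i x_i^{\#\{\text{entries equal to } i\}}$. **Beads.** Colour 1 is blue, colour 2 is red. On the top boundary there is a path of colour $j$ at column $\beta^{(j)}_m-m+1$ for each row index $m$ of $\beta^{(j)}$; on the bottom boundary there is a path of colour $j$ at column $\gamma^{(j)}_m-m+1$ for each $m$. On a given boundary a path is a singleton if no path of the other colour is at the same column of that boundary. The associated sequence of beads consists of two rows: the top (resp. bottom) row has one bead for each singleton path on the top (resp. bottom) boundary, of the same colour, in the same left-to-right order as the columns. Each bead is labelled by the total number of paths (of both colours, singleton or not) on the same boundary located in columns strictly to its right. **Matchings.** A matching is a set of arcs such that every bead is an endpoint of exactly one arc, and each arc joins either two beads of different colours in the same row or two beads of the same colour in different rows. It is non-crossing if the arcs, drawn in the strip between the two rows, do not cross; equivalently, listing all beads as top row left to right followed by bottom row right to left, there are no positions $p<q<r<s$ with $p$ joined to $r$ and $q$ joined to $s$. **Arc weights.** - Arc joining two blue beads in different rows, top label $i$, bottom label $j$: $w=t^{(j-i)/2}$. - Arc joining two red beads in different rows, top label $j$, bottom label $i$: $w=t^{(j-i)/2}$. - Arc in the top row joining a red bead with label $j$ and a blue bead with label $i$: $w=t^{(j-i+1)/2}$ if the red bead is to the left of the blue one, $w=t^{(j-i-1)/2}$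 if the blue bead is to the left. - Arc in the bottom row joining a red bead with label $i$ and a blue bead with label $j$: $w=t^{(j-i+1)/2}$ if the red bead is to the left of the blue one, $w=t^{(j-i-1)/2}$ if the blue bead is to the left. *)

(* Defs.v *)
From HB Require Import structures.
From mathcomp Require Import all_boot all_order all_algebra.
From mathcomp Require Import mpoly.

Set Implicit Arguments.
Unset Strict Implicit.
Unset Printing Implicit Defensive.

Import Order.TTheory GRing.Theory Num.Theory.
Local Open Scope ring_scope.

(* Rows and columns are numbered from 1.  A partition is the sequence of all
   its parts, zero parts included. *)

Definition is_partition (s : seq nat) : bool := sorted geq s.

Definition part (s : seq nat) (i : nat) : nat := nth 0%N s i.-1.

Record skew_partition := SkewPartition {
  outer : seq nat;
  inner : seq nat;
  outer_partition : is_partition outer;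
  inner_partition : is_partition inner;
  (* [all2] also forces the two sequences to have the same length *)
  inner_sub_outer : all2 leq inner outer
}.

Definition position := (nat * nat)%type.

Definition content (p : position) : int := p.2%:Z - p.1%:Z.

Definition rows (S : skew_partition) : seq nat := iota 1 (size (outer S)).

Definition cells (S : skew_partition) : seq position :=
  [seq (i, j) | i <- rows S,
                j <- iota (part (inner S) i).+1
                          (part (outer S) i - part (inner S) i)].

Section LLT.

Variable n : nat.

(* The letter i : 'I_n stands for the positive integer i + 1. *)
Definition filling (S : skew_partition) := {ffun seq_sub (cells S) -> 'I_n}.

Definition value (S : skew_partition) (T : filling S) (x : seq_sub (cells S)) :
  nat := (T x).+1.

Definition entry (S : skew_partition) (T : filling S) (p : position) :
  option nat := omap (value T) (insub p).

Definition semistandard (S : skew_partition) (T : filling S) : bool :=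
  [forall x : seq_sub (cells S), forall y : seq_sub (cells S),
     (((val x).1 == (val y).1) && ((val x).2 < (val y).2)%N
        ==> (value T x <= value T y)%N)
  && (((val x).2 == (val y).2) && ((val x).1 < (val y).1)%N
        ==> (value T x < value T y)%N)].

(* The positions u = (r, c) such that u and (r, c + 1) may be the two
   adjacent positions of a triple: inner_r <= c <= outer_r. *)
Definition left_positions (S : skew_partition) : seq position :=
  [seq (r, c) | r <- rows S,
                c <- iota (part (inner S) r)
                          (part (outer S) r - part (inner S) r).+1].

Definition right_of (u : position) : position := (u.1, u.2.+1).

(* The missing entries of u and of its right neighbour are read as 0 and as
   infinity, respectively. *)
Definition coinversion_triple (S1 S2 : skew_partition)
    (T1 : filling S1) (T2 : filling S2)
    (v : seq_sub (cells S1)) (u : position) : bool :=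
  [&& content (val v) == content (right_of u),
      (odflt 0%N (entry T2 u) <= value T1 v)%N
    & oapp (leq (value T1 v)) true (entry T2 (right_of u))].

Definition coinv (S1 S2 : skew_partition)
    (T1 : filling S1) (T2 : filling S2) : nat :=
  (\sum_(v : seq_sub (cells S1))
    count (coinversion_triple T1 T2 v) (left_positions S2))%N.

Definition multiplicity (S : skew_partition) (T : filling S) (i : 'I_n) : nat :=
  #|[set x | T x == i]|.

Definition LLT (R : comNzRingType) (t : R) (S1 S2 : skew_partition) :
    {mpoly R[n]} :=
  \sum_(T1 : filling S1 | semistandard T1)
  \sum_(T2 : filling S2 | semistandard T2)
    t ^+ coinv T1 T2 *:
      \prod_(i < n) 'X_i ^+ (multiplicity T1 i + multiplicity T2 i).

End LLT.

(* A bead remembers the column of its path, so that "to the left of" can be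
   read off the bead. *)
Record bead := Bead {
  on_top : bool;
  is_red : bool;
  column : int;
  label : nat
}.

Definition path_columns (s : seq nat) : seq int :=
  [seq (part s m)%:Z - m%:Z + 1 | m <- iota 1 (size s)].

(* The beads of one boundary, from left to right; s1 and s2 are the blue and
   the red partition of that boundary. *)
Definition bead_row (top : bool) (s1 s2 : seq nat) : seq bead :=
  let blue := path_columns s1 in
  let red := path_columns s2 in
  let singleton c := (c \in blue) (+) (c \in red) in
  [seq Bead top (c \in red) c (count (fun d => c < d) (blue ++ red))
     | c <- sort <=%R (filter singleton (blue ++ red))].

(* The top row from left to right, then the bottom row from right to left. *)
Definition beads (S1 S2 : skew_partition) : seq bead :=
  bead_row true (outer S1) (outer S2)
    ++ rev (bead_row false (inner S1) (inner S2)).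

Section Matchings.

Variable bs : seq bead.

Definition nth_bead (p : 'I_(size bs)) : bead := tnth (in_tuple bs) p.

(* An arc is the pair of the places of its endpoints in bs, smaller one
   first. *)
Definition bead_arc := ('I_(size bs) * 'I_(size bs))%type.

Definition is_arc (a : bead_arc) : bool :=
  let x := nth_bead a.1 in
  let y := nth_bead a.2 in
  (a.1 < a.2)%N &&
  ((on_top x == on_top y) && (is_red x != is_red y)
   || (on_top x != on_top y) && (is_red x == is_red y)).

Definition is_matching (M : {set bead_arc}) : bool :=
  [forall a in M, is_arc a] &&
  [forall p : 'I_(size bs), #|[set a in M | (a.1 == p) || (a.2 == p)]| == 1%N].

Definition noncrossing (M : {set bead_arc}) : bool :=
  [forall a in M, forall b in M,
     ~~ [&& a.1 < b.1, b.1 < a.2 & a.2 < b.2]%N].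

Definition noncrossing_matching (M : {set bead_arc}) : bool :=
  is_matching M && noncrossing M.

(* Twice the exponent of t in the weight of an arc joining x and y, where x
   precedes y: if the rows differ, x is in the top row. *)
Definition bead_exponent (x y : bead) : int :=
  if on_top x != on_top y then
    if is_red x then (label x)%:Z - (label y)%:Z
    else (label y)%:Z - (label x)%:Z
  else
    let: (red, blue) := if is_red x then (x, y) else (y, x) in
    (if on_top x then (label red)%:Z - (label blue)%:Z
     else (label blue)%:Z - (label red)%:Z)
    + (if column red < column blue then 1 else -1).

(* The weight of an arc; sqrt_t stands for t^(1/2). *)
Definition weight (F : fieldType) (sqrt_t : F) (a : bead_arc) : F :=
  sqrt_t ^ bead_exponent (nth_bead a.1) (nth_bead a.2).

End Matchings.

(* The coefficient field: t^(1/2) is an indeterminate over the integers. *)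
Definition coef_field : fieldType := {fraction {poly int}}.

Definition sqrt_t : coef_field := tofrac ('X : {poly int}).

Definition t : coef_field := sqrt_t ^+ 2.

(* Main.v *)
(* Put t^(1/2) = s.  The LLT polynomial is a matrix entry of a product of row
   transfer matrices acting on configurations of blue and red particles on a
   line, and the row transfer matrix commutes with a lowering operator of
   U_q(sl_2), which turns blue singletons into red ones.  Call a bead positive
   when it is red on top or blue on the bottom.  With the uncoloured
   configurations fixed, the matrix entry becomes a function f of the set of
   positive beads, and the commutation says that, up to explicit scalars
   kappa, f is q-invariant: the sum of q^(number of later elements of B)
   f(B minus i) over i in B vanishes for each (k+1)-subset B of the 2k beads.

   A matching that is the unique non-crossing one admits no exchange of two
   neighbouring arcs, which forces the signs of the beads to form two cyclic
   blocks, a segment U of k beads and its complement W.  Summing the relations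
   over all B with a given number of elements in U compares f(U) to f(W), and
   the resulting power of s is the weight of any matching of the beads.
   Exchanging the two shapes exchanges positive and negative beads. *)
Require Import Defs.
From mathcomp Require Import all_boot all_order all_algebra.
From mathcomp Require Import mpoly.
From mathcomp Require Import ring zify.

Set Implicit Arguments.
Unset Strict Implicit.
Unset Printing Implicit Defensive.

Import Order.TTheory GRing.Theory Num.Theory.

(** * Invariant functions on subsets of a cyclically ordered set *)

Local Open Scope ring_scope.

(** Behind the two blocks stands a classical fact: the q-invariants of 2k two-dimensional modules
    have a basis indexed by non-crossing matchings, and the vector of a matching is supported on the
    sets containing exactly one end of each arc. A cyclic segment of k beads is compatible with a
    single non-crossing matching, so the values at the segment and at its complement see the same
    basis vector; for other sets no such two-term relation can be expected. The basis itself is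
    never formed. Averaging the relations makes their coefficients add up to q-integers, which
    therefore have to be invertible. Turning the bottom boundary around makes one cyclic word of
    both rows. Removing a positive bead is then the lowering operator on the bottom and its
    transpose on top. The coefficients of these operators depend on all sites further right,
    including the doubly occupied ones, which carry no bead; the labels count the paths on those
    sites, and this is how they enter [kappa] and finally the weights. *)

Lemma bin2_square k : ('C(k, 2) + 'C(k.+1, 2) = k ^ 2)%N.
Proof. by elim: k => // k; rewrite -!mulnn !binS !bin1 !bin0; lia. Qed.

Lemma bin2_double k : ('C(k.*2, 2) = k ^ 2 + 'C(k, 2) + 'C(k, 2))%N.
Proof. by elim: k => // k; rewrite doubleS -!mulnn !binS !bin1 !bin0; lia. Qed.

Section QInvariance.

Variables (F : fieldType) (V : lmodType F) (I : finType).
Implicit Types (q : F) (rho : I -> nat) (A B D U : {set I}) (g : {set I} -> V).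

Definition above rho A i := #|[set j in A | (rho i < rho j)%N]|.

(** The numbers [above rho D i] are the ranks of the elements of [D] counted from the top, so each
    of 0, ..., #|D|-1 occurs once. *)
Lemma sum_above (u : F) rho D : injective rho ->
  \sum_(i in D) u ^+ above rho D i = \sum_(l < #|D|) u ^+ l.
Proof.
move=> rho_inj; have [m] := ubnP #|D|; elim: m D => // m IHm D ltDm.
have [->|[i0 i0D]] := set_0Vmem D; first by rewrite big_set0 cards0 big_ord0.
have [i iD0 min_i] := arg_minnP rho i0D; have iD : i \in D := iD0.
have aboveD1 j : j \in D :\ i -> above rho D j = above rho (D :\ i) j.
  rewrite !inE => /andP[ne_ji jD]; apply: eq_card => l; rewrite !inE.
  have [->|//] := eqVneq l i; rewrite ltnNge min_i ?andbF //.
have above_i : above rho D i = #|D :\ i|.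
  apply: eq_card => l; rewrite !inE; case lD: (l \in D); rewrite ?andbF //= andbT.
  by rewrite ltn_neqAle min_i // andbT (inj_eq rho_inj) eq_sym.
have cardD := cardsD1 i D; rewrite iD add1n in cardD.
rewrite (big_setD1 i iD) /= above_i cardD big_ord_recr /= addrC.
congr (_ + _); rewrite (eq_bigr _ (fun j jD => congr1 _ (aboveD1 j jD))).
by apply: IHm; rewrite -ltnS -cardD.
Qed.

Definition q_invariant q rho k g :=
  forall B, #|B| = k.+1 -> \sum_(i in B) q ^+ above rho B i *: g (B :\ i) = 0.

(** Double counting of the pairs (B, i) through A = B minus i: sums of relations over B become sums
    over the sets at which g is evaluated. *)
Lemma exchange_setU1 (W : nmodType) (P Q : pred {set I}) (D : {set I})
    (phi : {set I} -> I -> W) :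
    (forall A i, i \in D -> i \notin A -> P (i |: A) = Q A) ->
  \sum_(B | P B) \sum_(i in B :&: D) phi (B :\ i) i =
  \sum_(A | Q A) \sum_(i in D :\: A) phi A i.
Proof.
move=> PQ; rewrite !pair_big_dep /=.
rewrite (reindex_onto (fun p => (p.2 |: p.1, p.2)) (fun p => (p.1 :\ p.2, p.2)));
  last first.
  by case=> B i /=; rewrite inE => /andP[_ /andP[iB iD]]; rewrite setD1K.
apply: eq_big => [[A i]|[A i]] /=; rewrite !inE eqxx /=.
  case iD: (i \in D); rewrite ?andbF // !andbT.
  apply/andP/andP => [[PB /eqP[<-]]|[QA niA]].
    by rewrite setD11 -(PQ _ i) ?setD11 ?setD1K ?setU11 // ; split.
  by rewrite PQ // setU1K ?eqxx.
by move=> /andP[_ /eqP[eqA]]; rewrite eqA.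
Qed.

Section InitialSegment.

Variables (q : F) (rho : I -> nat) (k : nat) (g : {set I} -> V).
Hypotheses (q_neq0 : q != 0) (rho_inj : injective rho).
Hypotheses (rho_lt : forall i, (rho i < k.*2)%N) (cardI : #|I| = k.*2).
Hypothesis g_inv : q_invariant q rho k g.

Let U := [set i | (rho i < k)%N].

Let qint m : F := \sum_(l < m) q^-1 ^+ l.
Hypothesis qint_neq0 : forall m, qint m.+1 != 0.

(** With this weight, inserting i into A costs [rho i + above rho A i], which [above_add] turns into
    an inverse power counted in the complement of A. There the ranks of the elements that may be
    inserted form a q-integer. *)
Let layer j := \sum_(A : {set I} | (#|A| == k) && (#|A :&: U| == j))
   q ^+ (\sum_(i in A) rho i) *: g A.

Lemma card_rho (P : pred nat) : #|[set i | P (rho i)]| = count P (iota 0 k.*2).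
Proof.
have perm_rho : perm_eq (map rho (enum I)) (iota 0 k.*2).
  have uniq_rho : uniq (map rho (enum I)) by rewrite map_inj_uniq ?enum_uniq.
  apply: uniq_perm (iota_uniq _ _) _ => //.
  have [||//] := @uniq_min_size _ _ (iota 0 k.*2) uniq_rho.
    by move=> _ /mapP[i _ ->]; rewrite mem_iota /= add0n rho_lt.
  by rewrite size_iota size_map -cardE cardI.
by rewrite -(permP perm_rho) count_map cardsE cardE size_filter -enumT.
Qed.

Lemma card_rho_lt m : (m <= k.*2)%N -> #|[set i | (rho i < m)%N]| = m.
Proof.
move=> le_m; rewrite (card_rho (fun x => x < m)%N) -size_filter.
by have /= -> := @filter_iota_ltn 0 _ _ le_m; rewrite size_iota.
Qed.

Let cardU : #|U| = k. Proof. by rewrite card_rho_lt // -addnn leq_addr. Qed.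

Lemma above_add i A : (rho i + above rho A i + above rho (~: A) i = k.*2.-1)%N.
Proof.
rewrite -addnA; have <- : (above rho setT i = above rho A i + above rho (~: A) i)%N.
  rewrite /above -cardsUI [X in (_ = _ + X)%N](_ : _ = 0%N) ?addn0.
    by apply: eq_card => j; rewrite !inE -andb_orl orbN.
  by apply: eq_card0 => j; rewrite !inE; case: (j \in A); rewrite ?andbF.
have := cardsC [set j | (rho j <= rho i)%N].
rewrite (card_rho_lt (m := (rho i).+1)) ?rho_lt // cardI.
rewrite (_ : #|~: _| = above rho setT i); first by move=> <-; lia.
by apply: eq_card => j; rewrite !inE ltnNge.
Qed.

Lemma above_insert i A : above rho (i |: A) i = above rho A i.
Proof.
apply: eq_card => j; rewrite !inE; case: eqP => // ->.
by rewrite ltnn !andbF.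
Qed.

Lemma expr_above i A :
  q ^+ (rho i + above rho A i) = q ^+ k.*2.-1 * q^-1 ^+ above rho (~: A) i.
Proof.
rewrite -(above_add i A) (exprD _ (_ + _)) -mulrA -exprMn mulfV // expr1n.
by rewrite mulr1.
Qed.

Let sumU A D : #|A| = k ->
  \sum_(i in D :\: A) q ^+ (\sum_(j in i |: A) rho j) *:
     (q ^+ above rho (i |: A) i *: g A) =
  (q ^+ k.*2.-1 * \sum_(i in D :\: A) q^-1 ^+ above rho (~: A) i) *:
     (q ^+ (\sum_(j in A) rho j) *: g A).
Proof.
move=> cardA; rewrite mulr_sumr scaler_suml; apply: eq_bigr => i.
rewrite !inE => /andP[niA _].
rewrite big_setU1 //= above_insert -expr_above !scalerA -!exprD.
by congr (q ^+ _ *: _); lia.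
Qed.

(* The relations of all B with j+1 elements in U, weighted so that the flips
   leading to one A add up to a q-integer. *)
Lemma layer_rec j : (j < k)%N ->
  qint j.+1 *: layer j.+1 = - (q^-1 ^+ j * qint (k - j)) *: layer j.
Proof.
move=> lt_jk.
pose P (B : {set I}) := (#|B| == k.+1) && (#|B :&: U| == j.+1).
have rel : \sum_(B | P B) q ^+ (\sum_(i in B) rho i) *:
    (\sum_(i in B) q ^+ above rho B i *: g (B :\ i)) = 0.
  by apply: big1 => B /andP[/eqP cardB _]; rewrite g_inv // scaler0.
pose phi A i := q ^+ (\sum_(j in i |: A) rho j) *:
     (q ^+ above rho (i |: A) i *: g A).
have split_rel : \sum_(B | P B) \sum_(i in B :&: U) phi (B :\ i) i +
    \sum_(B | P B) \sum_(i in B :&: ~: U) phi (B :\ i) i = 0.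
  rewrite -[RHS]rel -big_split; apply: eq_bigr => B _ /=.
  rewrite scaler_sumr [RHS](bigID (mem U)) /=; congr (_ + _).
    by apply: eq_big => [i|i]; rewrite !inE // => /andP[iB _]; rewrite /phi setD1K.
  by apply: eq_big => [i|i]; rewrite !inE // => /andP[iB _]; rewrite /phi setD1K.
move: split_rel.
rewrite (exchange_setU1 (Q := fun A => (#|A| == k) && (#|A :&: U| == j))); last first.
  move=> A i iU niA; rewrite /P cardsU1 niA setIUl.
  rewrite (setIidPl _) ?sub1set // cardsU1 inE (negPf niA) /=.
  by rewrite !add1n !eqSS.
rewrite (exchange_setU1 (Q := fun A => (#|A| == k) && (#|A :&: U| == j.+1)));
  last first.
  move=> A i; rewrite inE => niU niA; rewrite /P cardsU1 niA setIUl.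
  rewrite (_ : [set i] :&: U = set0) ?set0U ?add1n ?eqSS //.
  by apply/setP=> l; rewrite !inE; case: eqP => // ->; rewrite inE in niU; apply: negPf.
pose c := q ^+ k.*2.-1.
have c_neq0 : c != 0 by rewrite expf_neq0.
(* For i in U, all j elements of the complement of A outside U lie above i and give the factor
   [q^-1 ^+ j]; the elements of U outside A give the ranks. *)
have -> : \sum_(A : {set I} | (#|A| == k) && (#|A :&: U| == j))
    \sum_(i in U :\: A) phi A i = (c * (q^-1 ^+ j * qint (k - j))) *: layer j.
  rewrite scaler_sumr; apply: eq_bigr => A /andP[/eqP cardA /eqP cardAU].
  rewrite sumU //; congr (c * _ *: _).
  have cardUA : #|U :\: A| = (k - j)%N.
    by rewrite cardsD cardU [U :&: A]setIC cardAU.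
  have cardWA : #|~: A :\: U| = j.
    have := cardsID U (~: A); have := cardsC A; rewrite cardI cardA.
    by rewrite (_ : ~: A :&: U = U :\: A) ?cardUA; [lia|rewrite setDE setIC].
  rewrite /qint -cardUA -(sum_above _ _ rho_inj) mulr_sumr.
  apply: eq_bigr => i iUA; rewrite -exprD; congr (_ ^+ _).
  rewrite -[in RHS]cardWA /above -cardsUI [X in (_ = _ + X)%N](_ : _ = 0%N).
    rewrite addn0; apply: eq_card => l; rewrite !inE.
    move: iUA; rewrite !inE => /andP[_ lt_ik].
    by case: (l \in A); case: (ltnP (rho i) (rho l)); lia.
  by apply: eq_card0 => l; rewrite !inE; case: (l \in A) => /=; lia.
(* For i outside U nothing of U lies above i, so only the ranks remain. *)
have -> : \sum_(A : {set I} | (#|A| == k) && (#|A :&: U| == j.+1))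
    \sum_(i in ~: U :\: A) phi A i = (c * qint j.+1) *: layer j.+1.
  rewrite scaler_sumr; apply: eq_bigr => A /andP[/eqP cardA /eqP cardAU].
  rewrite sumU //; congr (c * _ *: _).
  have cardUA : #|~: U :\: A| = j.+1.
    have := cardsID U A; have := cardsC U; rewrite cardI cardU cardA cardAU.
    have := cardsID A (~: U); rewrite (_ : ~: U :&: A = A :\: U); last first.
      by rewrite setDE setIC.
    lia.
  rewrite /qint -cardUA -(sum_above _ _ rho_inj).
  apply: eq_bigr => i iUA; congr (_ ^+ _); apply: eq_card => l; rewrite !inE.
  move: iUA; rewrite !inE -leqNgt => /andP[_ le_ki].
  by case: (l \in A) => //=; rewrite -leqNgt; case: (ltnP (rho i)) => [lt_il|];
    rewrite ?andbF // andbT; lia.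
rewrite -!scalerA -scalerDr => /eqP; rewrite scaler_eq0 (negPf c_neq0) /=.
by rewrite addrC addr_eq0 -scaleNr scalerA -mulNr => /eqP.
Qed.

(** Iterating [layer_rec] collects the q-integers 1, ..., k on one side and k, ..., 1 on the other,
    and they cancel. *)
Lemma layer_last : layer k = ((-1) ^+ k * q^-1 ^+ 'C(k, 2)) *: layer 0.
Proof.
have main j : (j <= k)%N -> (\prod_(l < j) qint l.+1) *: layer j =
    ((-1) ^+ j * q^-1 ^+ 'C(j, 2) * \prod_(l < j) qint (k - l)) *: layer 0.
  elim: j => [|j IHj] lt_jk; first by rewrite !big_ord0 !mulr1 !scale1r.
  rewrite big_ord_recr /= -[LHS]scalerA layer_rec // scalerA [_ * - _]mulrC.
  rewrite -[LHS]scalerA IHj 1?ltnW //.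
  rewrite scalerA big_ord_recr /= binS bin1 exprD exprS; congr (_ *: _); ring.
apply: (@scalerI _ _ (\prod_(l < k) qint l.+1)).
  by apply/prodf_neq0 => l _; apply: qint_neq0.
rewrite main // scalerA; congr (_ *: _); rewrite mulrC; congr (_ * _).
rewrite (reindex_inj rev_ord_inj); apply: eq_bigr => l _ /=.
by rewrite subKn // ltn_ord.
Qed.

(** The extreme layers have one term each. The ranks in U sum to C(k,2) and those in its complement
    to k^2 + C(k,2), which leaves the exponent k^2 - C(k,2) = C(k+1,2). *)
Lemma initial_segment_swap : g U = ((-1) ^+ k * q ^+ 'C(k.+1, 2)) *: g (~: U).
Proof.
have card_cU : #|~: U| = k by have := cardsC U; rewrite cardU cardI; lia.
have sum_lt m : (m <= k.*2)%N -> (\sum_(i | (rho i < m)%N) rho i)%N = 'C(m, 2).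
  elim: m => [|m IHm] lt_mk; first by rewrite big1.
  have : (0 < #|[set i | rho i == m]|)%N.
    by rewrite (card_rho (pred1 m)) count_uniq_mem ?iota_uniq // mem_iota lt_mk.
  case/card_gt0P=> i; rewrite inE => /eqP rho_i.
  rewrite (bigD1 i) /= ?rho_i // binS bin1 addnC -IHm 1?ltnW //.
  congr (_ + _)%N; apply: eq_bigl => j; rewrite -(inj_eq rho_inj) rho_i ltnS.
  by rewrite andbC -ltn_neqAle.
have sumU' : (\sum_(i in U) rho i)%N = 'C(k, 2).
  by rewrite -sum_lt; [apply: eq_bigl => i; rewrite inE|lia].
have sumW : (\sum_(i in ~: U) rho i = k ^ 2 + 'C(k, 2))%N.
  have := sum_lt _ (leqnn _); rewrite (eq_bigl xpredT) => [|i]; last exact: rho_lt.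
  rewrite (bigID (mem U)) /= sumU' (eq_bigl (fun i => i \in ~: U)) => [|i].
    by rewrite bin2_double; lia.
  by rewrite !inE.
have := layer_last; rewrite /layer (big_pred1 U) => [|A]; last first.
  apply/andP/eqP => [[/eqP cA /eqP cAU]|->]; last by rewrite setIid cardU eqxx.
  have /eqP <- : A :&: U == A by rewrite eqEcard subsetIl cA cAU leqnn.
  by apply/eqP; rewrite eqEcard subsetIr cAU cardU leqnn.
rewrite (big_pred1 (~: U)) => [|A]; last first.
  apply/andP/eqP => [[/eqP cA /eqP cAU]|->].
    apply/eqP; rewrite eqEcard cA card_cU leqnn andbT -disjoints_subset.
    by rewrite -setI_eq0 -cards_eq0 cAU.
  by rewrite card_cU setIC setICr cards0.
rewrite sumU' sumW scalerA => eqg.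
apply: (@scalerI _ _ (q ^+ 'C(k, 2))); first by rewrite expf_neq0.
rewrite eqg scalerA; congr (_ *: _).
rewrite -mulrA [RHS]mulrCA; congr (_ * _).
rewrite exprD mulrCA -exprMn mulVf // expr1n mulr1 -exprD; congr (_ ^+ _).
by rewrite bin2_square.
Qed.

End InitialSegment.

Lemma card_set_split (A : {set I}) (P Q R : pred I) :
    (forall i, i \in A -> P i = Q i || R i) ->
    (forall i, i \in A -> ~~ (Q i && R i)) ->
  #|[set i in A | P i]| = (#|[set i in A | Q i]| + #|[set i in A | R i]|)%N.
Proof.
move=> PQR QR; rewrite -cardsUI [X in (_ + X)%N]eq_card0 ?addn0.
  apply: eq_card => i; rewrite !inE; case iA: (i \in A) => //=; exact: PQR.
by move=> i; rewrite !inE; case iA: (i \in A) => //=; apply/negbTE/QR.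
Qed.

(* Moving the first a elements to the end of the order preserves q-invariance,
   up to a rescaling of g. *)
Lemma cyclic_segment_swap q rho k g a :
    q != 0 -> (forall m, \sum_(l < m.+1) q^-1 ^+ l != 0) ->
    injective rho -> (forall i, (rho i < k.*2)%N) -> #|I| = k.*2 ->
    q_invariant q rho k g -> (a <= k)%N ->
  let U := [set i | (a <= rho i < a + k)%N] in
  q ^+ (k.+1 * a) *: g U = ((-1) ^+ k * q ^+ 'C(k.+1, 2)) *: g (~: U).
Proof.
move=> q_neq0 qint_neq0 rho_inj rho_lt cardI g_inv le_ak U.
pose sigma i := (if a <= rho i then rho i - a else rho i + (k.*2 - a))%N.
pose late A := #|[set i in A | (a <= rho i)%N]|.
pose early A := #|[set i in A | (rho i < a)%N]|.
have late_early A : (late A + early A = #|A|)%N.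
  rewrite -(card_set_split (P := xpredT)) => [|i _|i _]; last 2 first.
  - by rewrite ltnNge orbN.
  - by rewrite ltnNge andbN.
  by apply: eq_card => i; rewrite !inE andbT.
pose h A := q ^+ (k.+1 * late A) *: g A.
have h_inv : q_invariant q sigma k h.
  (* [c] is the common shift of exponents between the relations for [rho] and [sigma]. A late i
     gains [early B] elements above it and its removal costs k+1 in the weight; an early i loses
     [late B] elements above it and costs nothing. The shifts agree because early B + late B =
     k+1. *)
  move=> B cardB; pose c := (early B + k.+1 * late B - k.+1)%N.
  have le_c : (k.+1 <= early B + k.+1 * late B)%N.
    by have := late_early B; rewrite cardB; nia.
  rewrite -[RHS](scaler0 _ (q ^+ c)) -[X in _ *: X](g_inv B cardB) scaler_sumr.
  apply: eq_bigr => i iB; rewrite /h !scalerA -!exprD; congr (q ^+ _ *: _).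
  have [le_ai|lt_ia] := leqP a (rho i).
    have -> : above sigma B i = (above rho B i + early B)%N.
      apply: card_set_split => j _ /=; rewrite /sigma ?le_ai;
      by have := rho_lt i; have := rho_lt j; case: (leqP a (rho j)); lia.
    have : late B = (late (B :\ i)).+1.
      rewrite /late (cardsD1 i) !inE iB le_ai add1n; congr _.+1.
      by apply: eq_card => j; rewrite !inE andbA.
    by rewrite /c; move=> ->; lia.
  have -> : above rho B i = (above sigma B i + late B)%N.
    apply: card_set_split => j _ /=; rewrite /sigma ?(leqNgt a (rho i)) ?lt_ia /=;
    by have := rho_lt i; have := rho_lt j; case: (leqP a (rho j)); lia.
  have -> : late (B :\ i) = late B.
    apply: eq_card => j; rewrite !inE; case: eqVneq => // ->.
    by rewrite leqNgt lt_ia /= !andbF.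
  by have := late_early B; rewrite cardB /c; lia.
have sigma_inj : injective sigma.
  move=> i j eq_ij; apply: rho_inj; move: eq_ij (rho_lt i) (rho_lt j); rewrite /sigma.
  by case: (leqP a (rho i)); case: (leqP a (rho j)); lia.
have sigma_lt i : (sigma i < k.*2)%N.
  by move: (rho_lt i); rewrite /sigma; case: (leqP a (rho i)); lia.
have cardU : #|U| = k.
  rewrite -[RHS](card_rho_lt sigma_inj sigma_lt cardI (m := k)); last by lia.
  apply: eq_card => i; rewrite !inE /sigma; move: (rho_lt i).
  by case: (leqP a (rho i)); lia.
have lateU : late U = k.
  by rewrite -[RHS]cardU; apply: eq_card => i; rewrite !inE; lia.
have late_cU : late (~: U) = (k - a)%N.
  have := late_early setT; rewrite cardsT cardI.
  have -> : early setT = a.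
    rewrite -[RHS](card_rho_lt rho_inj rho_lt cardI (m := a)); last by lia.
    by apply: eq_card => i; rewrite !inE.
  have -> : late setT = (late U + late (~: U))%N.
    rewrite /late -cardsUI [X in (_ + X)%N]eq_card0 ?addn0 => [|i]; last first.
      by rewrite !inE; lia.
    by apply: eq_card => i; rewrite !inE; lia.
  by rewrite lateU; lia.
have := initial_segment_swap q_neq0 sigma_inj sigma_lt cardI h_inv qint_neq0.
have -> : [set i | (sigma i < k)%N] = U.
  apply/setP=> i; rewrite !inE /sigma; move: (rho_lt i).
  by case: (leqP a (rho i)); lia.
rewrite /h lateU late_cU scalerA => eqU.
apply: (@scalerI _ _ (q ^+ (k.+1 * (k - a)))); first by rewrite expf_neq0.
rewrite scalerA -exprD -mulnDr subnK // eqU scalerA.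
by rewrite mulrC.
Qed.

End QInvariance.

(** * Matchings and exchange of arcs *)

Local Open Scope nat_scope.

Definition positive (x : bead) := is_red x == on_top x.

(** [a] is the first place where the word leaves its first letter and [e] the first return. A second
    departure at i would give the forbidden alternation at 0, a, e, i. *)
Lemma two_blocks (w : seq bool) :
    (forall p q r s : nat, p < q -> q < r -> r < s -> s < size w ->
       nth false w p = nth false w r -> nth false w q = nth false w s ->
       nth false w p = nth false w q) ->
  exists b a e, a <= e <= size w /\
    forall i, i < size w -> nth false w i = b (+) (a <= i < e).
Proof.
case: w => [|b w] no_alt; first by exists false, 0, 0.
set v := b :: w in no_alt *.
pose a := find (predC1 b) v; pose e := (a + find (pred1 b) (drop a v)).
have le_a : a <= size v by exact: find_size.
have le_e : e <= size v.
  by rewrite -leq_subRL // -size_drop find_size.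
exists b, a, e; split; first by rewrite leq_addr.
move=> i lt_i; case: (ltnP i a) => [lt_ia|le_ai].
  have /negbT := before_find false lt_ia; rewrite /= negbK => /eqP ->.
  by rewrite addbF.
have a_gt0 : 0 < a by rewrite /a /= eqxx.
have va : nth false v a != b.
  have := @nth_find _ false (predC1 b) v; rewrite has_find -/a.
  by rewrite (leq_ltn_trans le_ai lt_i) => /(_ isT).
case: (ltnP i e) => [lt_ie|le_ei] /=.
  have lt_ia : i - a < find (pred1 b) (drop a v) by rewrite ltn_subLR.
  have /negbT := before_find false lt_ia; rewrite /= nth_drop subnKC //.
  by case: (nth _ _ _); case: (b).
rewrite addbF; apply/eqP; apply: contraT => vi.
have ve : nth false v e = b.
  have := @nth_find _ false (pred1 b) (drop a v); rewrite nth_drop -/e.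
  by rewrite has_find size_drop ltn_subRL (leq_ltn_trans le_ei lt_i) => /(_ isT)/eqP.
have lt_ae : a < e.
  by rewrite ltn_neqAle leq_addr andbT; apply: contraNneq va => ->; rewrite ve.
have lt_ei : e < i.
  by rewrite ltn_neqAle le_ei andbT; apply: contraNneq vi => <-; rewrite ve.
have := no_alt 0 a e i a_gt0 lt_ae lt_ei lt_i; rewrite ve /= => /(_ erefl).
by move: va vi; case: (nth _ _ a); case: (nth _ _ i); case: (b) => // _ _ /(_ erefl).
Qed.

Section Surgery.

Variable bs : seq bead.
Implicit Types (M : {set bead_arc bs}) (p q r s : 'I_(size bs)).

Let sgn p := positive (nth_bead p).

(** The sign convention unites the two kinds of arcs, within a row and between the rows. From here
    on the surgery on matchings only sees a word of signs. *)
Lemma is_arcE (a : bead_arc bs) : is_arc a = (a.1 < a.2) && (sgn a.1 != sgn a.2).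
Proof.
rewrite /is_arc /sgn /positive; case: (_ < _) => //=.
by case: (on_top _); case: (on_top _); case: (is_red _); case: (is_red _).
Qed.

Definition incident p (a : bead_arc bs) : nat := (a.1 == p) || (a.2 == p).

Lemma is_matchingP M :
  reflect ((forall a, a \in M -> is_arc a) /\ forall p, \sum_(a in M) incident p a = 1)
          (is_matching M).
Proof.
have degE p : \sum_(a in M) incident p a = #|[set a in M | (a.1 == p) || (a.2 == p)]|.
  by rewrite -sum1dep_card big_mkcondr; apply: eq_bigr => a _; rewrite /incident; case: orP.
apply: (iffP andP) => -[arcM degM]; split.
- by move=> a; apply: (forall_inP arcM).
- by move=> p; rewrite degE; apply/eqP/(forallP degM).
- exact/forall_inP.
- by apply/forallP=> p; rewrite -degE degM.
Qed.

Lemma noncrossingP M :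
  reflect (forall a b, a \in M -> b \in M -> ~ (a.1 < b.1 /\ b.1 < a.2 /\ a.2 < b.2))
          (noncrossing M).
Proof.
apply: (iffP forall_inP) => [ncM a b aM bM|ncM a aM].
  by move=> [lt1 [lt2 lt3]]; have /forall_inP/(_ b bM) := ncM a aM; rewrite lt1 lt2 lt3.
by apply/forall_inP=> b bM; apply/negP=> /and3P[*]; apply: (ncM a b).
Qed.

Lemma matching_endpoint M p : is_matching M ->
  exists2 a, a \in M & (a.1 == p) || (a.2 == p).
Proof.
move=> /andP[_ /forallP/(_ p)/cards1P[a Ma]]; exists a.
  by have := set11 a; rewrite -Ma inE => /andP[].
by have := set11 a; rewrite -Ma inE => /andP[].
Qed.

Lemma matching_disjoint M a b p : is_matching M -> a \in M -> b \in M ->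
  (a.1 == p) || (a.2 == p) -> (b.1 == p) || (b.2 == p) -> a = b.
Proof.
move=> /andP[_ /forallP/(_ p)/cards1P[c Mc]] aM bM ap bp.
have : a \in [set c] by rewrite -Mc inE aM.
have : b \in [set c] by rewrite -Mc inE bM.
by rewrite !inE => /eqP -> /eqP ->.
Qed.

Let crossing (a b : bead_arc bs) := [&& a.1 < b.1, b.1 < a.2 & a.2 < b.2].

(** The equality of incidences says that c and d have the same four ends as a and b, so every bead
    keeps degree one and only crossings with c or d can be new. *)
Lemma exchange_arcs M (a b c d : bead_arc bs) :
    noncrossing_matching M -> a \in M -> b \in M -> a != b ->
    is_arc c -> is_arc d -> c \notin M -> d \notin M -> c != d ->
    (forall z, incident z a + incident z b = incident z c + incident z d) ->
    ~~ crossing c d -> ~~ crossing d c ->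
    (forall e, e \in M -> e != a -> e != b ->
       [&& ~~ crossing e c, ~~ crossing c e, ~~ crossing e d & ~~ crossing d e]) ->
  noncrossing_matching (c |: (d |: (M :\ a :\ b))).
Proof.
move=> /andP[/is_matchingP[arcM degM] /noncrossingP ncM] aM bM ne_ab arc_c arc_d.
move=> ncM_c ndM ne_cd deg_eq ncd ndc nc_e.
apply/andP; split.
  apply/is_matchingP; split=> [e|z].
    rewrite !inE => /orP[/eqP->//|/orP[/eqP->//|/and3P[_ _]]]; exact: arcM.
  rewrite big_setU1 ?big_setU1 ?inE ?(negPf ne_cd) ?(negPf ncM_c) ?(negPf ndM) ?andbF //=.
  have := degM z; rewrite (big_setD1 a aM) (big_setD1 b) /= ?inE 1?eq_sym ?ne_ab //.
  by rewrite !addnA deg_eq.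
apply/noncrossingP=> e f.
rewrite !inE => /orP[/eqP->|/orP[/eqP->|/and3P[eb ea eM]]];
  move=> /orP[/eqP->|/orP[/eqP->|/and3P[fb fa fM]]] crossed.
- by case: crossed; rewrite ltnn.
- by move: ncd; rewrite /crossing; case: crossed => -> [-> ->].
- by have /and4P[_ + _ _] := nc_e f fM fa fb; rewrite /crossing; case: crossed => -> [-> ->].
- by move: ndc; rewrite /crossing; case: crossed => -> [-> ->].
- by case: crossed; rewrite ltnn.
- by have /and4P[_ _ _ +] := nc_e f fM fa fb; rewrite /crossing; case: crossed => -> [-> ->].
- by have /and4P[+ _ _ _] := nc_e e eM ea eb; rewrite /crossing; case: crossed => -> [-> ->].
- by have /and4P[_ _ + _] := nc_e e eM ea eb; rewrite /crossing; case: crossed => -> [-> ->].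
- exact: (ncM e f).
Qed.

Section UniqueMatching.

Variable M : {set bead_arc bs}.
Hypothesis M_nc : noncrossing_matching M.
Hypothesis M_unique : forall M' : {set bead_arc bs}, noncrossing_matching M' -> M' = M.

Let M_arc a : a \in M -> a.1 < a.2 /\ sgn a.2 = ~~ sgn a.1.
Proof.
case/andP: M_nc => /is_matchingP[arcM _] _ /arcM; rewrite is_arcE => /andP[-> /=].
by split=> //; move: b; case: (sgn _); case: (sgn _).
Qed.

Let M_disjoint a b p : a \in M -> b \in M ->
  (a.1 == p) || (a.2 == p) -> (b.1 == p) || (b.2 == p) -> a = b.
Proof. by case/andP: M_nc => mM _; apply: matching_disjoint. Qed.

Let M_cross a b : a \in M -> b \in M -> ~ (a.1 < b.1 /\ b.1 < a.2 /\ a.2 < b.2).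
Proof. by case/andP: M_nc => _ /noncrossingP; apply. Qed.

Let M_apart a b : a \in M -> b \in M -> a != b ->
  [/\ a.1 <> b.1 :> nat, a.1 <> b.2 :> nat, a.2 <> b.1 :> nat & a.2 <> b.2 :> nat].
Proof.
move=> aM bM ne_ab; split=> /val_inj eq_p; case/eqP: ne_ab.
- by apply: (@M_disjoint _ _ a.1); rewrite ?eqxx ?eq_p ?eqxx ?orbT.
- by apply: (@M_disjoint _ _ a.1); rewrite ?eqxx ?eq_p ?eqxx ?orbT.
- by apply: (@M_disjoint _ _ a.2); rewrite ?eqxx ?eq_p ?eqxx ?orbT.
- by apply: (@M_disjoint _ _ a.2); rewrite ?eqxx ?eq_p ?eqxx ?orbT.
Qed.

Let exchange_absurd (a b c d : bead_arc bs) : a \in M -> b \in M -> a != b ->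
    is_arc c -> is_arc d -> c \notin M -> d \notin M -> c != d ->
    (forall z, incident z a + incident z b = incident z c + incident z d) ->
    ~~ crossing c d -> ~~ crossing d c ->
    (forall e, e \in M -> e != a -> e != b ->
       [&& ~~ crossing e c, ~~ crossing c e, ~~ crossing e d & ~~ crossing d e]) ->
  False.
Proof.
move=> aM bM ne_ab arc_c arc_d ncM ndM ne_cd deg ncd ndc nce.
have /M_unique eqM := exchange_arcs M_nc aM bM ne_ab arc_c arc_d ncM ndM ne_cd deg ncd ndc nce.
by case/negP: ncM; rewrite -eqM setU11.
Qed.

(* The gap between two exchangeable arcs decreases when one of them is
   replaced by an arc that separates them. *)
Lemma no_exchangeable_arcs m p q r s :
    p < q -> q < r -> r < s ->
    sgn r = sgn p -> sgn q = ~~ sgn p -> sgn s = ~~ sgn p ->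
    ((p, q) \in M /\ (r, s) \in M /\ size bs + p + r < m + q + s) \/
    ((p, s) \in M /\ (q, r) \in M /\ s + q < m + p + r) -> False.
Proof.
(* On the circle of beads the two alternatives are the same situation. In both, [m] bounds the
   length of the region between the arcs: everything outside [p,q] and [r,s] when they are side by
   side, the stretches [p,q] and [r,s] when they are nested. *)
elim: m p q r s => [|m IHm] p q r s lt_pq lt_qr lt_rs rp qp sp.
  by have := ltn_ord s; clear -lt_pq lt_qr lt_rs; lia.
have ne_pq : (p == q) = false by rewrite -val_eqE ltn_eqF //= lt_pq.
have ne_qr : (q == r) = false by rewrite -val_eqE ltn_eqF //= lt_qr.
have ne_rs : (r == s) = false by rewrite -val_eqE ltn_eqF //= lt_rs.
have ne_pr : (p == r) = false by rewrite -val_eqE ltn_eqF //= (ltn_trans lt_pq lt_qr).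
have ne_qs : (q == s) = false by rewrite -val_eqE ltn_eqF //= (ltn_trans lt_qr lt_rs).
have ne_ps : (p == s) = false by rewrite -val_eqE ltn_eqF //= (ltn_trans (ltn_trans lt_pq lt_qr) lt_rs).
have deg_eq z : incident z (p, q) + incident z (r, s) =
    incident z (p, s) + incident z (q, r).
  rewrite /incident /=.
  have [<-|np] := eqVneq p z; first by rewrite [r == p]eq_sym [s == p]eq_sym [q == p]eq_sym ne_pr ne_ps ne_pq.
  have [<-|nq] := eqVneq q z; first by rewrite [s == q]eq_sym [r == q]eq_sym ne_qs ne_qr.
  have [<-|nr] := eqVneq r z; first by rewrite [s == r]eq_sym ne_rs.
  by case: (s == z).
case=> [[pqM [rsM lt_m]]|[psM [qrM lt_m]]].
  have ne_ab : (p, q) != (r, s) by rewrite xpair_eqE ne_pr.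
  (* These are the only arcs of [M] that can cross (p,s) or (q,r). Such an arc is exchangeable with
     (p,q) or with (r,s), depending on its sign, and is closer to it. *)
  pose sep (e : bead_arc bs) :=
    (q < e.1 < r) && (s < e.2) || (e.1 < p) && (q < e.2 < r).
  have [/exists_inP[[u v] eM sep_e]|no_sep] := boolP [exists e in M, sep e].
    have [/= lt_e se] := M_arc eM; case/orP: sep_e => /= /andP[].
      move=> /andP[h1 h2] h3; have := ltn_ord v.
      case: (boolP (sgn u == sgn p)) => [/eqP ep|/negPf nep] lt_v.
        apply: (IHm p q u v) => //; rewrite ?se ?ep //.
        by left; split=> //; split=> //; clear -h1 h2 h3 lt_v lt_m lt_e lt_rs lt_pq; lia.
      have ep : sgn u = ~~ sgn p by move: nep; case: (sgn u); case: (sgn p).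
      apply: (IHm u r s v) => //; rewrite ?se ?ep ?rp ?sp ?negbK //.
      by right; split=> //; split=> //; clear -h1 h2 h3 lt_v lt_m lt_e lt_rs lt_pq; lia.
    move=> h1 /andP[h2 h3]; have := ltn_ord v; have := ltn_ord s.
    case: (boolP (sgn u == sgn p)) => [/eqP ep|/negPf nep] lt_s lt_v.
      apply: (IHm u v r s) => //; rewrite ?se ?ep //.
      by left; split=> //; split=> //; clear -h1 h2 h3 lt_v lt_s lt_m lt_e lt_rs lt_pq; lia.
    have ep : sgn u = ~~ sgn p by move: nep; case: (sgn u); case: (sgn p).
    apply: (IHm u p q v) => //; rewrite ?se ?ep ?negbK ?qp //.
    by right; split=> //; split=> //; clear -h1 h2 h3 lt_v lt_s lt_m lt_e lt_rs lt_pq; lia.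
  apply: (@exchange_absurd (p, q) (r, s) (p, s) (q, r)) => //.
  - by rewrite is_arcE /= sp; case: (sgn p); rewrite /= ?andbT; clear -lt_pq lt_qr lt_rs; lia.
  - by rewrite is_arcE /= qp rp; case: (sgn p); rewrite /= ?andbT; clear -lt_pq lt_qr lt_rs; lia.
  - apply/negP=> cM; have := M_disjoint pqM cM (p := p).
    by rewrite /= !eqxx => /(_ isT isT) [] /eqP; rewrite ne_qs.
  - apply/negP=> cM; have := M_disjoint pqM cM (p := q).
    by rewrite /= !eqxx orbT => /(_ isT isT) [] /eqP; rewrite ne_pq.
  - by rewrite xpair_eqE ne_pq.
  - by rewrite /crossing /=; clear -lt_pq lt_qr lt_rs; lia.
  - by rewrite /crossing /=; clear -lt_pq lt_qr lt_rs; lia.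
  move=> [u v] eM ea eb.
  have := M_apart eM pqM ea; have := M_apart eM rsM eb.
  have := M_cross eM pqM; have := M_cross pqM eM; have := M_cross eM rsM.
  have := M_cross rsM eM; have [] := M_arc eM.
  have : ~~ sep (u, v) by apply: contra no_sep => h; apply/exists_inP; exists (u, v).
  by rewrite /sep /crossing /= => h1 h2 _ h3 h4 h5 h6 [h7 h8 h9 h10] [h11 h12 h13 h14];
    clear -lt_pq lt_qr lt_rs h1 h2 h3 h4 h5 h6 h7 h8 h9 h10 h11 h12 h13 h14;
    apply/and4P; split; apply/negP=> /and3P[c1 c2 c3]; lia.
have ne_ab : (p, s) != (q, r) by rewrite xpair_eqE ne_pq.
pose sep (e : bead_arc bs) := (p < e.1 < q) && (r < e.2 < s).
have [/exists_inP[[u v] eM sep_e]|no_sep] := boolP [exists e in M, sep e].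
  have [/= lt_e se] := M_arc eM; case/andP: sep_e => /= /andP[h1 h2] /andP[h3 h4].
  case: (boolP (sgn u == sgn p)) => [/eqP ep|/negPf nep].
    apply: (IHm u q r v) => //; rewrite ?se ?ep //.
    by right; split=> //; split=> //; clear -h1 h2 h3 h4 lt_m lt_e lt_rs lt_pq; lia.
  have ep : sgn u = ~~ sgn p by move: nep; case: (sgn u); case: (sgn p).
  apply: (IHm p u v s) => //; rewrite ?se ?ep ?negbK //.
  by right; split=> //; split=> //; clear -h1 h2 h3 h4 lt_m lt_e lt_rs lt_pq; lia.
apply: (@exchange_absurd (p, s) (q, r) (p, q) (r, s)) => //.
- by rewrite is_arcE /= qp; case: (sgn p); rewrite /= ?andbT; clear -lt_pq lt_qr lt_rs; lia.
- by rewrite is_arcE /= sp rp; case: (sgn p); rewrite /= ?andbT; clear -lt_pq lt_qr lt_rs; lia.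
- apply/negP=> cM; have := M_disjoint psM cM (p := p).
  by rewrite /= !eqxx => /(_ isT isT) [] /eqP; rewrite eq_sym ne_qs.
- apply/negP=> cM; have := M_disjoint psM cM (p := s).
  by rewrite /= !eqxx !orbT => /(_ isT isT) [] /eqP; rewrite ne_pr.
- by rewrite xpair_eqE ne_pr.
- by rewrite /crossing /=; clear -lt_pq lt_qr lt_rs; lia.
- by rewrite /crossing /=; clear -lt_pq lt_qr lt_rs; lia.
move=> [u v] eM ea eb.
have := M_apart eM psM ea; have := M_apart eM qrM eb.
have := M_cross eM psM; have := M_cross psM eM; have := M_cross eM qrM.
have := M_cross qrM eM; have [] := M_arc eM.
have : ~~ sep (u, v) by apply: contra no_sep => h; apply/exists_inP; exists (u, v).
by rewrite /sep /crossing /= => h1 h2 _ h3 h4 h5 h6 [h7 h8 h9 h10] [h11 h12 h13 h14];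
    clear -lt_pq lt_qr lt_rs h1 h2 h3 h4 h5 h6 h7 h8 h9 h10 h11 h12 h13 h14;
    apply/and4P; split; apply/negP=> /and3P[c1 c2 c3]; lia.
Qed.

(** If nested, arcs with opposite signs at their left ends would have four ends of alternating sign
    and could be exchanged. *)
Let opposite_sequential p p' q q' : (p, p') \in M -> (q, q') \in M ->
  sgn q = ~~ sgn p -> p' < q \/ q' < p.
Proof.
move=> aM bM opp; have [/= lt_p sp'] := M_arc aM; have [/= lt_q sq'] := M_arc bM.
have ne : (p, p') != (q, q').
  by apply: contra_eqN opp => /eqP[<- _]; case: (sgn p).
have [/= n1 n2 n3 n4] := M_apart aM bM ne.
have := M_cross aM bM; have := M_cross bM aM => /= c1 c2.
have [lt_qp|lt_pq|/val_inj eq_pq] := ltngtP q p; last by case: n1; rewrite eq_pq.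
  have [lt|le] := ltnP q' p; first by right.
  have lt_p'q' : p' < q' by clear -n1 n2 n3 n4 c1 c2 lt_qp le; lia.
  exfalso; apply: (@no_exchangeable_arcs (size bs + q' + p).+1 q p p' q') => //.
  + by rewrite sp' opp.
  + by rewrite opp negbK.
  + by right; split=> //; split=> //; clear -lt_p'q' lt_qp; have := ltn_ord q'; lia.
have [lt|le] := ltnP p' q; first by left.
have lt_q'p' : q' < p' by clear -n1 n2 n3 n4 c1 c2 lt_pq le; lia.
exfalso; apply: (@no_exchangeable_arcs (size bs + p' + q).+1 p q q' p') => //.
+ by rewrite sq' opp negbK.
+ by right; split=> //; split=> //; clear -lt_q'p' lt_pq; lia.
Qed.

(** Here the alternation of the four ends arises when the arcs lie side by side. *)
Let same_nested p p' q q' : (p, p') \in M -> (q, q') \in M ->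
  sgn q = sgn p -> p <= q /\ q' <= p' \/ q <= p /\ p' <= q'.
Proof.
move=> aM bM same; have [/= lt_p sp'] := M_arc aM; have [/= lt_q sq'] := M_arc bM.
have [[-> ->]|ne] := eqVneq (p, p') (q, q'); first by left.
have [/= n1 n2 n3 n4] := M_apart aM bM ne.
have := M_cross aM bM; have := M_cross bM aM => /= c1 c2.
have [lt_p'q|le1] := ltnP p' q.
  exfalso; apply: (@no_exchangeable_arcs (size bs + q + p).+1 p p' q q') => //.
  + by rewrite sq' same.
  + by left; split=> //; split=> //; clear -lt_p'q lt_p lt_q; lia.
have [lt_q'p|le2] := ltnP q' p.
  exfalso; apply: (@no_exchangeable_arcs (size bs + q + p).+1 q q' p p') => //.
  + by rewrite sp' same.
  + by left; split=> //; split=> //; clear -lt_q'p lt_p lt_q; lia.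
by clear -n1 n2 n3 n4 c1 c2 le1 le2; lia.
Qed.

Let arc_of p : exists q, sgn q = ~~ sgn p /\
  (p < q /\ (p, q) \in M \/ q < p /\ (q, p) \in M).
Proof.
case/andP: M_nc => mM _; have [[u v] uvM] := matching_endpoint p mM.
have [/= lt_uv sv] := M_arc uvM.
case/orP=> /= /eqP <-; first by exists v; split=> //; left.
by exists u; split; [rewrite sv negbK | right].
Qed.

(** The arcs whose left end has a given sign form a nested chain, and the two chains lie side by
    side. The signs thus read i of one kind, i+j of the other, then j of the first. *)
Lemma unique_no_alternation p q r s : p < q -> q < r -> r < s ->
  sgn r = sgn p -> sgn q = ~~ sgn p -> sgn s = ~~ sgn p -> False.
Proof.
move=> lt_pq lt_qr lt_rs rp qp sp.
have [p' [sp' arc_p]] := arc_of p; have [q' [sq' arc_q]] := arc_of q.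
have [r' [sr' arc_r]] := arc_of r; have [s' [ss' arc_s]] := arc_of s.
rewrite rp in sr'; rewrite qp negbK in sq'; rewrite sp negbK in ss'.
have [lt_r Rarc] : r' < r /\ (r', r) \in M.
  case: arc_r => // -[lt_r Rarc]; case: arc_q => -[lt_q Qarc].
    case: arc_p => -[lt_p Parc].
      have := opposite_sequential Parc Qarc qp.
      by have := same_nested Parc Rarc rp; clear -lt_pq lt_qr lt_p lt_q lt_r; lia.
    have := same_nested Parc Qarc; rewrite sp' qp => /(_ erefl).
    by clear -lt_pq lt_q lt_p; lia.
  have := same_nested Qarc Rarc; rewrite sq' rp => /(_ erefl).
  by clear -lt_qr lt_q lt_r; lia.
have [lt_s Sarc] : s' < s /\ (s', s) \in M.
  case: arc_s => // -[lt_s Sarc].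
  have := same_nested Rarc Sarc; rewrite sr' sp => /(_ erefl).
  by clear -lt_rs lt_s lt_r; lia.
have RS := opposite_sequential Sarc Rarc; rewrite sr' ss' in RS; have {}RS := RS erefl.
case: arc_q => -[lt_q Qarc].
  case: arc_p => -[lt_p Parc].
    have := opposite_sequential Sarc Qarc; rewrite ss' qp => /(_ erefl).
    have := same_nested Sarc Parc; rewrite ss' => /(_ erefl).
    have := opposite_sequential Parc Qarc qp.
    by clear -lt_pq lt_qr lt_rs lt_p lt_q lt_r lt_s RS; lia.
  have := same_nested Parc Qarc; rewrite sp' qp => /(_ erefl).
  by clear -lt_pq lt_q lt_p; lia.
have := same_nested Qarc Sarc; rewrite ss' sq' => /(_ erefl).
by clear -lt_qr lt_rs lt_q lt_r lt_s RS; lia.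
Qed.

Lemma unique_two_blocks : exists b a e, a <= e <= size bs /\
  forall p, sgn p = b (+) (a <= p < e).
Proof.
pose w := map positive bs.
have sgnE p : sgn p = nth false w p.
  by rewrite (nth_map (nth_bead p)) ?ltn_ord // /sgn {1}/nth_bead (tnth_nth (nth_bead p)).
case: (@two_blocks w) => [p q r s lt_pq lt_qr lt_rs|b [a [e []]]]; rewrite size_map => lt_s.
  have lt_r := ltn_trans lt_rs lt_s; have lt_q := ltn_trans lt_qr lt_r.
  have lt_p := ltn_trans lt_pq lt_q.
  rewrite -[p]/(nat_of_ord (Ordinal lt_p)) -[q]/(nat_of_ord (Ordinal lt_q)).
  rewrite -[r]/(nat_of_ord (Ordinal lt_r)) -[s]/(nat_of_ord (Ordinal lt_s)).
  rewrite -!sgnE => pr qs.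
  case: (eqVneq (sgn (Ordinal lt_p)) (sgn (Ordinal lt_q))) => // npq.
  exfalso; apply: (@unique_no_alternation (Ordinal lt_p) (Ordinal lt_q) (Ordinal lt_r) (Ordinal lt_s)) => //.
    by move: npq; case: (sgn _); case: (sgn _).
  by move: npq; rewrite -qs; case: (sgn _); case: (sgn _).
by move=> eqw; exists b, a, e; split=> // p; rewrite sgnE eqw.
Qed.

End UniqueMatching.
End Surgery.

(** * The weight of a matching *)

Local Open Scope ring_scope.

Definition bead_before (x y : bead) : bool :=
  if on_top x then on_top y ==> (column x < column y)
  else ~~ on_top y && (column y < column x).

Definition bead_sign (x : bead) : int := if positive x then 1 else -1.

(** The share of a bead in twice the exponent of any arc ending at it. The shift by one on top
    cancels within a top arc, and on an arc between the rows it cancels the [bead_sign x] of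
    [bead_exponentE]. Only that sign of the first end depends on the matching. *)
Definition bead_charge (x : bead) : int :=
  bead_sign x * ((label x)%:Z - (on_top x)%:Z).

Lemma bead_exponentE (x y : bead) : bead_before x y -> positive x != positive y ->
  bead_exponent x y = bead_charge x + bead_charge y + bead_sign x.
Proof.
rewrite /bead_before /bead_exponent /bead_charge /bead_sign /positive.
case: x => [[] [] c l]; case: y => [[] [] c' l'] //=;
  rewrite ?(mulr1, mulN1r) /=;
  try (by move=> lt_c _; rewrite ?lt_c ?(lt_gtF lt_c); lia); lia.
Qed.

Lemma card_interval N a e : (a <= e <= N)%N ->
  (\sum_(p < N) (a <= p < e) = e - a)%N.
Proof.
case/andP=> le_ae le_eN.
rewrite -(big_mkord xpredT (fun p => (a <= p < e)%N : nat)).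
rewrite (@big_cat_nat _ _ _ a) //= ?(leq_trans le_ae) //.
rewrite (@big_cat_nat _ _ _ e a N) //=.
rewrite big_nat_cond big1 => [|p]; last by lia.
rewrite [X in (_ + (_ + X))%N]big_nat_cond [X in (_ + (_ + X))%N]big1 => [|p]; last by lia.
rewrite add0n addn0 (eq_big_nat _ _ (F2 := fun=> 1%N)) => [|p]; last by lia.
by rewrite sum_nat_const_nat muln1.
Qed.

Section MatchingSums.

Variable bs : seq bead.
Variable M : {set bead_arc bs}.
Hypothesis M_matching : is_matching M.

Lemma matching_sum (V : nmodType) (phi : 'I_(size bs) -> V) :
  \sum_(a in M) (phi a.1 + phi a.2) = \sum_p phi p.
Proof.
have [arcM degM] := is_matchingP _ M_matching.
transitivity (\sum_p \sum_(a in M) phi p *+ incident p a); last first.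
  by apply: eq_bigr => p _; rewrite sumrMnr degM.
rewrite exchange_big /=; apply: eq_bigr => a /arcM; rewrite is_arcE => /andP[lt_a _].
have ne_a : a.2 != a.1 by rewrite -val_eqE gtn_eqF.
rewrite (bigD1 a.1) //= (bigD1 a.2) //= big1 => [|p /andP[p1 p2]].
  by rewrite /incident !eqxx orbT addr0.
by rewrite /incident eq_sym (negPf p1) eq_sym (negPf p2).
Qed.

Lemma prod_weight (F : fieldType) (s : F) : s != 0 ->
  \prod_(a in M) weight s a =
  s ^ (\sum_(a in M) bead_exponent (nth_bead a.1) (nth_bead a.2)).
Proof.
move=> s_neq0; symmetry.
by apply: (big_morph (fun z : int => s ^ z)) => [x y|]; rewrite ?expfzDr ?expr0z.
Qed.

(** Each arc has exactly one end in the segment, which therefore has #|M| beads. An arc starts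
    outside the segment exactly when it has an end among the first a beads, so a arcs start with one
    sign and k - a with the other, whatever the matching. *)
Lemma blocks_exponent b a e : pairwise bead_before bs ->
    (a <= e <= size bs)%N ->
    (forall p : 'I_(size bs), positive (nth_bead p) = b (+) (a <= p < e)%N) ->
  exists k, [/\ size bs = k.*2, e = (a + k)%N, (a <= k)%N &
    \sum_(c in M) bead_exponent (nth_bead c.1) (nth_bead c.2) =
    \sum_(p < size bs) bead_charge (nth_bead p) +
    (if b then a.*2%:Z - k%:Z else k%:Z - a.*2%:Z)].
Proof.
move=> bs_ordered le_ae sgnE; have [arcM degM] := is_matchingP _ M_matching.
have arc_sgn c : c \in M -> (c.1 < c.2)%N /\ ((a <= c.1 < e)%N != (a <= c.2 < e)%N).
  move=> /arcM; rewrite is_arcE => /andP[-> /=]; rewrite !sgnE.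
  by case: b {sgnE} => /=; case: (_ <= c.1 < _)%N; case: (_ <= c.2 < _)%N.
have sizeE : size bs = #|M|.*2.
  have := matching_sum (fun=> 1%N); rewrite sum_nat_const sum1_card card_ord.
  by move=> sizeE; rewrite -muln2; apply: esym sizeE.
have eE : e = (a + #|M|)%N.
  have := matching_sum (fun p => (a <= p < e)%N : nat); rewrite card_interval //.
  rewrite (eq_bigr (fun=> 1%N)) => [|c /arc_sgn[_]]; last first.
    by case: (_ <= c.1 < _)%N; case: (_ <= c.2 < _)%N.
  by rewrite sum1_card; lia.
exists #|M|; split=> //; first by lia.
pose early (p : 'I_(size bs)) : int := (p < a)%N.
have sum_early : \sum_(c in M) (early c.1 + early c.2) = a%:Z.
  rewrite matching_sum -[in RHS](subn0 a).
  rewrite -(card_interval (a := 0) (e := a) (N := size bs)); last by lia.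
  by rewrite (big_morph Posz PoszD (erefl _)).
rewrite (eq_bigr (fun c => bead_charge (nth_bead c.1) + bead_charge (nth_bead c.2)
    + (if b then -1 else 1) * (1 - (early c.1 + early c.2) *+ 2))).
  rewrite big_split /= (matching_sum (fun p => bead_charge (nth_bead p))) -mulr_sumr; congr (_ + _).
  rewrite sumrB sumrMnl sum_early sumr_const natz mulr2n -addnn PoszD; case: b {sgnE}; ring.
move=> c cM; have [lt_c ne_c] := arc_sgn c cM.
rewrite bead_exponentE; last 2 first.
- rewrite /nth_bead !(tnth_nth (nth_bead c.1)).
  by apply: (pairwiseP _ bs_ordered); rewrite ?inE.
- by have := arcM c cM; rewrite is_arcE => /andP[].
congr (_ + _); rewrite /bead_sign sgnE /early.
rewrite -PoszD; have -> : ((c.1 < a)%N + (c.2 < a)%N = ~~ (a <= c.1 < e)%N)%N.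
  have := ltn_ord c.2; move: sizeE eE lt_c ne_c.
  move: #|M| (nat_of_ord c.1) (nat_of_ord c.2) => m x y.
  by move: (size bs) => N -> ->; clear; lia.
by case: b {sgnE}; case: (_ <= _ < _)%N.
Qed.

End MatchingSums.

(** * The transfer matrix and the lowering operator *)

Definition state := (bool * bool)%type.
Definition blue_site : state := (true, false).
Definition red_site : state := (false, true).

(* One colour at one site: a path coming from the left (h) or from below (v)
   leaves upwards (v') or to the right (the result); None if two paths meet or
   if no path is there to leave upwards. *)
Definition bit_step (h v v' : bool) : option bool :=
  if h && v then None else
  if v' then (if h || v then Some false else None) else Some (h || v).

Lemma bit_step_conserves h v v' h' : bit_step h v v' = Some h' -> (h + v = v' + h')%N.
Proof. by case: h; case: v; case: v' => //= -[<-]. Qed.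

Fixpoint state_seqs (N : nat) : seq (seq state) :=
  if N is N'.+1 then
    [seq v :: s | v <- [:: (false, false); (false, true); (true, false); (true, true)],
                  s <- state_seqs N']
  else [:: [::]].

Lemma mem_state_seqs N s : (s \in state_seqs N) = (size s == N).
Proof.
elim: N s => [|N IHN] s; first by rewrite inE -size_eq0.
apply/allpairsPdep/idP => [[v [u [_ uN ->]]]|]; first by rewrite /= eqSS -IHN.
case: s => // v s; rewrite /= eqSS -IHN => sN; exists v, s; split=> //.
by case: v => [[] []].
Qed.

Section Transfer.

Variables (K : comNzRingType) (t : K).
Implicit Types (x : K) (h v : state) (b s top : seq state) (phi psi : seq state -> K).

(* A blue path leaving a column to the right contributes x, and t if a red path
   visits that column; a red one contributes x. *)
Fixpoint row_weight x h b top : K :=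
  match b, top with
  | [::], [::] => (h == (false, false))%:R
  | v :: b', v' :: top' =>
    if (bit_step h.1 v.1 v'.1, bit_step h.2 v.2 v'.2) is (Some i, Some j) then
      x ^+ (i + j) * t ^+ (i && (h.2 || v.2)) * row_weight x (i, j) b' top'
    else 0
  | _, _ => 0
  end.

Definition site_twist v : K := (- 1) ^+ v.1 * (- t) ^+ v.2.

Definition twist s : K := \prod_(v <- s) site_twist v.

(* [lower] and [raise] are the lowering operator of U_q(sl_2), acting by its
   iterated coproduct on the sites, and its transpose. *)
Fixpoint lower s phi : K :=
  if s is v :: s' then
    (if v == blue_site then twist s' * phi (red_site :: s') else 0)
    + lower s' (fun u => phi (v :: u))
  else 0.

Fixpoint raise s phi : K :=
  if s is v :: s' then
    (if v == red_site then twist s' * phi (blue_site :: s') else 0)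
    + raise s' (fun u => phi (v :: u))
  else 0.

Lemma eq_lower s phi psi : (forall u, size u = size s -> phi u = psi u) ->
  lower s phi = lower s psi.
Proof.
elim: s phi psi => //= v s IHs phi psi eq_phi; rewrite eq_phi //.
by congr (_ + _); apply: IHs => u us; rewrite eq_phi //= us.
Qed.

Lemma eq_raise s phi psi : (forall u, size u = size s -> phi u = psi u) ->
  raise s phi = raise s psi.
Proof.
elim: s phi psi => //= v s IHs phi psi eq_phi; rewrite eq_phi //.
by congr (_ + _); apply: IHs => u us; rewrite eq_phi //= us.
Qed.

Lemma lowerZ s c phi : lower s (fun u => c * phi u) = c * lower s phi.
Proof.
elim: s phi => [|v s IHs] phi /=; first by rewrite mulr0.
by rewrite IHs mulrDr; case: eqP => _; rewrite ?mulr0 // mulrCA.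
Qed.

Lemma raiseZ s c phi : raise s (fun u => c * phi u) = c * raise s phi.
Proof.
elim: s phi => [|v s IHs] phi /=; first by rewrite mulr0.
by rewrite IHs mulrDr; case: eqP => _; rewrite ?mulr0 // mulrCA.
Qed.

Lemma lower_sum (I : Type) (r : seq I) s (phi : I -> seq state -> K) :
  lower s (fun u => \sum_(i <- r) phi i u) = \sum_(i <- r) lower s (phi i).
Proof.
elim: s phi => [|v s IHs] phi /=; first by rewrite big1.
by rewrite IHs big_split /=; congr (_ + _); case: eqP => _; rewrite ?mulr_sumr // big1.
Qed.

Lemma raise_sum (I : Type) (r : seq I) s (phi : I -> seq state -> K) :
  raise s (fun u => \sum_(i <- r) phi i u) = \sum_(i <- r) raise s (phi i).
Proof.
elim: s phi => [|v s IHs] phi /=; first by rewrite big1.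
by rewrite IHs big_split /=; congr (_ + _); case: eqP => _; rewrite ?mulr_sumr // big1.
Qed.

Lemma raise_lower_adjoint N phi psi :
  \sum_(s <- state_seqs N) phi s * lower s psi =
  \sum_(s <- state_seqs N) raise s phi * psi s.
Proof.
elim: N phi psi => [|N IHN] phi psi; first by rewrite !big_seq1 /= mulr0 mul0r.
rewrite !big_allpairs_dep /=.
under eq_bigr do [under eq_bigr do rewrite mulrDr; rewrite big_split IHN].
under [RHS]eq_bigr do [under eq_bigr do rewrite mulrDl; rewrite big_split].
rewrite !big_split; congr (_ + _); rewrite !big_cons !big_nil /=.
have zl v : \sum_(s <- state_seqs N) phi (v :: s) * 0 = 0.
  by apply: big1 => s _; rewrite mulr0.
have zr v : \sum_(s <- state_seqs N) 0 * psi (v :: s) = 0.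
  by apply: big1 => s _; rewrite mul0r.
rewrite !zl !zr !addr0 !add0r.
by apply: eq_bigr => s _; rewrite mulrCA mulrA.
Qed.

(** Every site conserves the number of paths of each colour, and the twist is multiplicative in
    these numbers. This is the commutation with the group-like element of the coproduct. *)
Lemma row_weight_twist x h b top :
  site_twist h * twist b * row_weight x h b top = twist top * row_weight x h b top.
Proof.
elim: b top h => [|v b IHb] [|v' top] h //=; rewrite ?mulr0 //.
  by rewrite /twist !big_nil; case: h => [[] []]; rewrite /= ?mulr0 // /site_twist !mulr1.
rewrite /twist !big_cons -/(twist b) -/(twist top).
case step1: bit_step => [i|]; last by rewrite !mulr0.
case step2: bit_step => [j|]; last by rewrite !mulr0.
have e1 := bit_step_conserves step1; have e2 := bit_step_conserves step2.
have eq_twist : site_twist h * site_twist v = site_twist v' * site_twist (i, j).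
  by rewrite /site_twist mulrACA [RHS]mulrACA -!exprD /= e1 e2.
set c := x ^+ _ * _; set w := row_weight _ _ _ _.
transitivity (site_twist h * site_twist v * (c * (twist b * w))); first by ring.
transitivity (site_twist v' * c * (site_twist (i, j) * twist b * w)).
  by rewrite eq_twist; ring.
by rewrite IHb -/w mulrACA -!mulrA.
Qed.

(** The horizontal edge [h] acts as one more site to the left of the bottom row, and the right-hand
    side is the lowering operator on [h :: b]. Keeping [h] arbitrary lets the identity be proved one
    site at a time. *)
Lemma row_intertwines x h b top : size b = size top ->
  raise top (row_weight x h b) =
  (if h == blue_site then twist b * row_weight x red_site b top else 0)
  + lower b (fun b' => row_weight x h b' top).
Proof.
elim: b top h => [|v b IHb] [|v' top] h //=.
  by case: h => [[] []] /=; rewrite ?mulr0 !addr0.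
case=> /IHb {}IHb.
have twistM c h' : twist top * (c * row_weight x h' b top) =
    c * (site_twist h' * twist b * row_weight x h' b top).
  by rewrite mulrCA row_weight_twist.
have raise0 : raise top (fun=> 0) = 0.
  by rewrite -[RHS](mul0r (raise top (fun=> 0))) -raiseZ; apply: eq_raise => u _; rewrite mul0r.
have lower0 : lower b (fun=> 0) = 0.
  by rewrite -[RHS](mul0r (lower b (fun=> 0))) -lowerZ; apply: eq_lower => u _; rewrite mul0r.
have twist_cons : twist (v :: b) = site_twist v * twist b by rewrite /twist big_cons.
rewrite twist_cons.
(* With the twist of the remaining top moved to the bottom by [twistM], one site is left: a check
   over the four states of each of [h], [v], [v']. *)
case: h => [[] []]; case: v {twist_cons} => [[] []]; case: v' => [[] []] /=;
  rewrite ?raise0 ?lower0 ?raiseZ ?lowerZ ?IHb ?twistM /= /site_twist /=; ring.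
Qed.

Fixpoint transfer (xs : seq K) b top : K :=
  if xs is x :: xs' then
    \sum_(m <- state_seqs (size b))
      row_weight x (false, false) b m * transfer xs' m top
  else (b == top)%:R.

Lemma identity_intertwines b top : size b = size top ->
  raise top (fun u => (b == u)%:R) = lower b (fun u => (u == top)%:R).
Proof.
elim: b top => [|v b IHb] [|v' top] //= [/IHb {}IHb].
have raiseE : raise top (fun u => (v :: b == v' :: u)%:R) =
    (v == v')%:R * raise top (fun u => (b == u)%:R).
  by rewrite -raiseZ; apply: eq_raise => u _; rewrite eqseq_cons -mulnb natrM.
have lowerE : lower b (fun u => (v :: u == v' :: top)%:R) =
    (v == v')%:R * lower b (fun u => (u == top)%:R).
  by rewrite -lowerZ; apply: eq_lower => u _; rewrite eqseq_cons -mulnb natrM.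
rewrite raiseE lowerE IHb !eqseq_cons [v == blue_site]eq_sym; congr (_ + _).
have [eq_bt|ne_bt] := eqVneq b top; last by rewrite /= !andbF !mulr0 !if_same.
by rewrite eq_bt; case: (v) => [[] []]; case: (v') => [[] []]; rewrite /= ?mulr0.
Qed.

(** No path enters a row from the left, so the boundary term of [row_intertwines] vanishes, and
    adjointness carries the operator across the intermediate state. *)
Lemma transfer_intertwines xs b top : size b = size top ->
  raise top (transfer xs b) = lower b (fun b' => transfer xs b' top).
Proof.
elim: xs b top => [|x xs IHxs] b top eq_size /=; first exact: identity_intertwines.
rewrite raise_sum.
transitivity (\sum_(m <- state_seqs (size b))
    row_weight x (false, false) b m * lower m (fun m' => transfer xs m' top)).
  apply: eq_big_seq => m; rewrite mem_state_seqs => /eqP size_m.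
  by rewrite raiseZ IHxs ?size_m.
rewrite raise_lower_adjoint.
transitivity (\sum_(m <- state_seqs (size b))
    lower b (fun b' => transfer xs m top * row_weight x (false, false) b' m)).
  apply: eq_big_seq => m; rewrite mem_state_seqs => /eqP size_m.
  by rewrite row_intertwines ?size_m // add0r lowerZ mulrC.
rewrite -lower_sum; apply: eq_lower => u size_u; rewrite size_u.
by apply: eq_bigr => m _; rewrite mulrC.
Qed.

End Transfer.

(** * Recolouring the singletons *)

Definition singleton_site (v : state) := v.1 (+) v.2.

Definition site_size (v : state) : nat := v.1 + v.2.

Fixpoint recolor (s : seq state) (w : seq bool) : seq state :=
  if s is v :: s' then
    if singleton_site v then (~~ head false w, head false w) :: recolor s' (behead w)
    else v :: recolor s' w
  else [::].

Fixpoint site_labels (s : seq state) : seq nat :=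
  if s is v :: s' then
    if singleton_site v then sumn (map site_size s') :: site_labels s' else site_labels s'
  else [::].

Fixpoint doubles_right (s : seq state) : seq nat :=
  if s is v :: s' then
    if singleton_site v then count (pred1 (true, true)) s' :: doubles_right s'
    else doubles_right s'
  else [::].

Lemma size_recolor s w : size (recolor s w) = size s.
Proof. by elim: s w => //= v s IHs w; case: ifP => _ /=; rewrite IHs. Qed.

Lemma size_doubles_right s : size (doubles_right s) = size (site_labels s).
Proof. by elim: s => //= v s IHs; case: ifP => _ /=; rewrite IHs. Qed.

Lemma sumn_site_size s :
  sumn (map site_size s) = (size (site_labels s) + (count (pred1 (true, true)) s).*2)%N.
Proof.
elim: s => //= v s ->.
by case: v => [[] []]; rewrite /site_size /= ?doubleS; lia.
Qed.

(** The paths further right sit on singleton sites or in pairs on double sites, and neither number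
    depends on the colouring. The doubled term matches the power of t that double sites contribute
    to the twist. *)
Lemma nth_site_labels s i : (i < size (site_labels s))%N ->
  nth 0%N (site_labels s) i =
  (size (site_labels s) - i.+1 + (nth 0%N (doubles_right s) i).*2)%N.
Proof.
elim: s i => //= v s IHs i; case: ifP => _ /=; last exact: IHs.
case: i => [|i] /=; first by rewrite sumn_site_size subn1.
by rewrite ltnS => /IHs ->; rewrite subSS.
Qed.

Section RecoloredOperators.

Variables (K : comNzRingType) (t : K).
Implicit Types (s : seq state) (w : seq bool) (phi : seq state -> K).

(** A double site contributes (-1)(-t) = t, so the sign counts singletons only. *)
Lemma twist_recolor s w : size w = size (site_labels s) ->
  twist t (recolor s w) = (-1) ^+ size w *
    t ^+ (count id w + count (pred1 (true, true)) s).
Proof.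
elim: s w => [|v s IHs] w /=.
  by move/size0nil=> ->; rewrite /twist big_nil mulr1.
rewrite /twist; case: ifP => sv.
  case: w => //= c w [/IHs IHw]; rewrite big_cons -/(twist _ _) IHw.
  case: v sv => [[] []] //= _; case: c; rewrite /site_twist /= ?exprS; ring.
move=> /IHs IHw; rewrite big_cons -/(twist _ _) IHw.
by case: v sv => [[] []] //= _; rewrite /site_twist /= ?addnS ?exprS; ring.
Qed.

Let coef s w i : K := (-1) ^+ (size w - i.+1) *
  t ^+ (count id (drop i.+1 w) + nth 0%N (doubles_right s) i).

Lemma raise_recolor s w phi : size w = size (site_labels s) ->
  raise t (recolor s w) phi = \sum_(0 <= i < size w)
    if nth false w i then coef s w i * phi (recolor s (set_nth false w i false)) else 0.
Proof.
elim: s w phi => [|v s IHs] w phi /=.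
  by move/size0nil=> ->; rewrite big_nil.
rewrite /coef /=; case: ifP => sv /=.
  case: w => //= c w [sw]; rewrite big_nat_recl //= drop0 subn1 -twist_recolor //.
  congr (_ + _); first by case: c.
  by rewrite IHs //; apply: eq_bigr => i _; rewrite subSS.
move=> sw; rewrite IHs // [X in X + _](_ : _ = 0) ?add0r //.
by case: v sv => [[] []].
Qed.

Lemma lower_recolor s w phi : size w = size (site_labels s) ->
  lower t (recolor s w) phi = \sum_(0 <= i < size w)
    if nth false w i then 0 else coef s w i * phi (recolor s (set_nth false w i true)).
Proof.
elim: s w phi => [|v s IHs] w phi /=.
  by move/size0nil=> ->; rewrite big_nil.
rewrite /coef /=; case: ifP => sv /=.
  case: w => //= c w [sw]; rewrite big_nat_recl //= drop0 subn1 -twist_recolor //.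
  congr (_ + _); first by case: c.
  by rewrite IHs //; apply: eq_bigr => i _; rewrite subSS.
move=> sw; rewrite IHs // [X in X + _](_ : _ = 0) ?add0r //.
by case: v sv => [[] []].
Qed.

End RecoloredOperators.

(** * The matrix entry as a q-invariant function of the set of positive beads *)

Section BeadSubsets.

Variable N : nat.
Implicit Type B : {set 'I_N}.

Definition mem_at B (i : nat) : bool := if insub i is Some x then x \in B else false.

Lemma mem_atE B (x : 'I_N) : mem_at B x = (x \in B).
Proof. by rewrite /mem_at valK. Qed.

Lemma mem_at_setD1 B (x : 'I_N) i : mem_at (B :\ x) i = (i != x) && mem_at B i.
Proof.
rewrite /mem_at; case: insubP => [y _ <-|]; last by rewrite andbF.
by rewrite !inE.
Qed.

Lemma count_mem_at B a m : count (mem_at B) (iota a m) = #|[set x in B | (a <= x < a + m)%N]|.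
Proof.
rewrite -size_filter cardE -(size_map val); apply: perm_size.
apply: uniq_perm.
- exact/filter_uniq/iota_uniq.
- by rewrite map_inj_uniq ?enum_uniq //; apply: val_inj.
move=> i; rewrite mem_filter mem_iota; apply/andP/mapP => [[]|[x]].
  rewrite /mem_at; case: insubP => // x _ <- xB le_x.
  by exists x; rewrite // mem_enum inE xB.
by rewrite mem_enum inE => /andP[xB le_x] ->; rewrite mem_atE.
Qed.

End BeadSubsets.

Lemma rev_iota_shift p q j : (j <= q)%N ->
  rev [seq (p + (q - i.+1))%N | i <- iota j (q - j)] = iota p (q - j).
Proof.
move=> le_jq; apply: (@eq_from_nth _ 0%N); rewrite size_rev size_map !size_iota // => i lt_i.
rewrite nth_rev ?size_map ?size_iota // (nth_map 0%N) ?size_iota; last by lia.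
by rewrite !nth_iota; lia.
Qed.

Section Invariance.

Variables (F : fieldType) (K : comAlgType F) (s : F) (xs : seq K).
Variables (top bot : seq state).
Hypotheses (s_neq0 : s != 0) (eq_size : size bot = size top).

Let p := size (site_labels top).
Let q := size (site_labels bot).

Variable N : nat.
Hypothesis NE : N = (p + q)%N.
Implicit Type A B : {set 'I_N}.

Let t : F := s ^+ 2.

Definition top_word A := mkseq (mem_at A) p.

(* The bottom beads are listed from right to left, and the positive ones are
   blue. *)
Definition bot_word A := mkseq (fun j => ~~ mem_at A (p + (q - j.+1))) q.

Definition recolored_transfer A : K :=
  transfer (s ^+ 2)%:A xs (recolor bot (bot_word A)) (recolor top (top_word A)).

Definition bead_label i := nth 0%N (site_labels top ++ rev (site_labels bot)) i.

(* Turns the coefficients of the flips on both boundaries into t^(above B i), up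
   to a factor depending only on B. *)
Definition kappa (i : nat) : F := (-1) ^+ i * s ^+ (bead_label i + i + (p <= i)%N).

Lemma top_word_setD1 B (x : 'I_N) : (x < p)%N ->
  top_word (B :\ x) = set_nth false (top_word B) x false.
Proof.
move=> lt_xp; apply: (@eq_from_nth _ false).
  by rewrite size_set_nth !size_mkseq; lia.
move=> i; rewrite size_mkseq => lt_ip; rewrite nth_set_nth /= !nth_mkseq //.
by rewrite mem_at_setD1; case: eqP.
Qed.

Lemma top_word_setD1_id B (x : 'I_N) : (p <= x)%N -> top_word (B :\ x) = top_word B.
Proof.
move=> le_px; apply: (@eq_from_nth _ false); rewrite !size_mkseq // => i lt_ip.
by rewrite !nth_mkseq // mem_at_setD1; case: eqP => //= eq_ix; lia.
Qed.

Lemma bot_word_setD1 B (x : 'I_N) j : (j < q)%N -> x = (p + (q - j.+1))%N :> nat ->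
  bot_word (B :\ x) = set_nth false (bot_word B) j true.
Proof.
move=> lt_jq xE; apply: (@eq_from_nth _ false).
  by rewrite size_set_nth !size_mkseq; lia.
move=> i; rewrite size_mkseq => lt_iq; rewrite nth_set_nth /= !nth_mkseq //.
rewrite mem_at_setD1 xE negb_and negbK.
have -> : (p + (q - i.+1) == p + (q - j.+1))%N = (i == j) by lia.
by case: eqP.
Qed.

Lemma bot_word_setD1_id B (x : 'I_N) : (x < p)%N -> bot_word (B :\ x) = bot_word B.
Proof.
move=> lt_xp; apply: (@eq_from_nth _ false); rewrite !size_mkseq // => i lt_iq.
by rewrite !nth_mkseq // mem_at_setD1; case: eqP => //= eq_ix; lia.
Qed.

Lemma sum_early (V : nmodType) (G : nat -> V) :
  \sum_(0 <= i < p) G i = \sum_(x < N) if (x < p)%N then G x else 0.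
Proof.
by rewrite big_mkord (big_ord_widen N) ?NE ?leq_addr // big_mkcond.
Qed.

Lemma sum_late (V : nmodType) (G : nat -> V) :
  \sum_(0 <= j < q) G j = \sum_(x < N) if (x < p)%N then 0 else G (q - (x - p).+1)%N.
Proof.
rewrite -(big_mkord xpredT (fun i => if (i < p)%N then 0 else G (q - (i - p).+1)%N)).
have le_pN : (p <= N)%N by rewrite NE leq_addr.
rewrite [RHS](@big_cat_nat _ _ _ p) //= [X in _ = X + _]big_nat_cond.
rewrite [X in _ = X + _]big1 ?add0r => [|i]; last by case/andP => /andP[_ ->].
rewrite -{1}[p]add0n big_addn NE addKn big_nat_rev add0n.
by apply: eq_big_nat => i lt_i; rewrite ltnNge leq_addl addnK.
Qed.

Lemma above_early B (x : 'I_N) : (x < p)%N ->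
  above val B x = (count id (drop x.+1 (top_word B)) + #|[set y in B | (p <= y)%N]|)%N.
Proof.
move=> lt_xp; rewrite /top_word /mkseq -map_drop drop_iota add0n count_map.
rewrite count_mem_at /above subnKC // (@card_set_split 'I_N _ (fun y => (x < y)%N) (fun y => (x < y < p)%N)
  (fun y : 'I_N => (p <= y)%N)) //= => y _; lia.
Qed.

(** The sites right of a bottom bead are listed before it, and a bottom bead is red when it is not
    in B. The red ones to the right are therefore the x - p earlier bottom beads minus those in
    B. *)
Lemma above_late B (x : 'I_N) j : x \in B -> (j < q)%N -> x = (p + (q - j.+1))%N :> nat ->
  (above val B x + (x - p)).+1 =
  (count id (drop j.+1 (bot_word B)) + #|[set y in B | (p <= y)%N]|)%N.
Proof.
move=> xB lt_jq xE; rewrite /bot_word /mkseq -map_drop drop_iota add0n count_map.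
have -> : count (preim (fun i => ~~ mem_at B (p + (q - i.+1))) id) (iota j.+1 (q - j.+1))
    = (x - p - #|[set y in B | (p <= y < x)%N]|)%N.
  have -> : #|[set y in B | (p <= y < x)%N]| = count (mem_at B) (iota p (q - j.+1)).
    by rewrite count_mem_at xE.
  have := count_predC (mem_at B) (iota p (q - j.+1)).
  rewrite size_iota -(rev_iota_shift p lt_jq) !count_rev !count_map.
  have -> : (x - p = q - j.+1)%N by lia.
  by move=> eq_c; rewrite -[X in _ = (X - _)%N]eq_c addKn; apply: eq_count.
rewrite (@card_set_split 'I_N _ (fun y => (p <= y)%N) (fun y => (p <= y < x)%N)
   (fun y : 'I_N => (x <= y)%N)); [|move=> y _ /=; lia..].
have -> : #|[set y in B | (x <= y)%N]| = (above val B x).+1.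
  rewrite (cardsD1 x) !inE xB leqnn add1n; congr _.+1.
  by apply: eq_card => y; rewrite !inE -val_eqE /=; case: (y \in B); lia.
have : (#|[set y in B | (p <= y < x)%N]| <= x - p)%N.
  have := count_mem_at B p (x - p); rewrite subnKC; last by lia.
  by move=> <-; rewrite -[X in (_ <= X)%N](size_iota p) count_size.
lia.
Qed.

Lemma scale_sign_alg (c : F) m e (y : K) :
  (-1) ^+ m * c%:A ^+ e * y = ((-1) ^+ m * c ^+ e) *: y.
Proof.
by rewrite -[RHS]mulr_algl -!in_algE rmorphM !rmorphXn rmorphN1.
Qed.

(** [transfer_intertwines] at the colouring given by B: each term of either side makes one positive
    bead negative, and the terms from the two boundaries enter with opposite signs. *)
Lemma recolored_relation B :
  \sum_(x in B) (t ^+ above val B x * kappa x) *: recolored_transfer (B :\ x) = 0.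
Proof.
pose b := #|[set x in B | (p <= x)%N]|.
pose C : F := (-1) ^+ p * s ^+ p * t ^+ b.
have size_top : size (top_word B) = p by rewrite size_mkseq.
have size_bot : size (bot_word B) = q by rewrite size_mkseq.
have eq_size' : size (recolor bot (bot_word B)) = size (recolor top (top_word B)).
  by rewrite !size_recolor.
have := transfer_intertwines (s ^+ 2)%:A xs eq_size'.
rewrite raise_recolor // lower_recolor // size_top size_bot sum_early sum_late => rel.
(* A top bead x has p - x - 1 singletons to its right; the extra [s] makes 1 + (p - x - 1) + x = p
   independent of x. *)
apply: (@scalerI _ _ s) => //; rewrite scaler0 scaler_sumr.
have /esym/eqP := congr1 ( *:%R C) rel; rewrite -subr_eq0 !scaler_sumr -sumrB => /eqP rel0.
rewrite -[RHS]rel0 big_mkcond; apply: eq_bigr => x _; have lt_xN := ltn_ord x.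
have [lt_xp|le_px] := ltnP x p.
  rewrite scaler0 sub0r nth_mkseq // mem_atE; case: ifP => xB; last by rewrite scaler0 oppr0.
  rewrite scale_sign_alg -top_word_setD1 // -[X in recolor bot X](bot_word_setD1_id _ lt_xp).
  rewrite -/(recolored_transfer _) !scalerA -scaleNr; congr (_ *: _).
  rewrite above_early // -/b /kappa leqNgt lt_xp addn0 /bead_label nth_cat lt_xp.
  rewrite nth_site_labels // -/p /t /C.
  set m := (p - x.+1)%N; set d := nth _ _ _; set c := count _ _.
  have sgn : (-1) ^+ p * (-1) ^+ m = - (-1) ^+ x :> F.
    rewrite -exprD (_ : (p + m)%N = (x + m.*2 + 1)%N); last by rewrite /m; lia.
    by rewrite exprD expr1 mulrN1 exprD -mul2n exprM sqrrN !expr1n mulr1.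
  have pow : s * (s ^+ 2) ^+ (c + b) * s ^+ (m + d.*2 + x) =
      s ^+ p * (s ^+ 2) ^+ b * (s ^+ 2) ^+ (c + d).
    by rewrite -!exprM -exprS -!exprD; congr (_ ^+ _); rewrite /m; lia.
  transitivity ((-1) ^+ x * (s * (s ^+ 2) ^+ (c + b) * s ^+ (m + d.*2 + x))).
    by ring.
  rewrite pow -[(-1) ^+ x]opprK -sgn !mulNr; congr (- _).
  by ring.
pose j := (q - (x - p).+1)%N.
have lt_jq : (j < q)%N by rewrite /j; lia.
have xE : x = (p + (q - j.+1))%N :> nat by rewrite /j; lia.
rewrite scaler0 subr0 -/j nth_mkseq // -xE mem_atE; case: ifP => xB /=; last by rewrite scaler0.
rewrite scale_sign_alg -(bot_word_setD1 _ _ xE) // -[X in recolor top X](top_word_setD1_id _ le_px).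
rewrite -/(recolored_transfer _) !scalerA; congr (_ *: _).
rewrite /kappa le_px /bead_label nth_cat ltnNge le_px /= nth_rev; last by rewrite -/q; lia.
rewrite -/p -/q nth_site_labels -/q; last by rewrite -/q; lia.
have := above_late xB lt_jq xE; rewrite -/b -/t /C.
set m := (q - j.+1)%N; set d := nth _ _ _; set c := count _ _ => aboveE.
have sgn : (-1) ^+ p * (-1) ^+ m = (-1) ^+ x :> F.
  by rewrite -exprD xE.
have pow : s * (s ^+ 2) ^+ above val B x * s ^+ (m + d.*2 + x + 1) =
    s ^+ p * (s ^+ 2) ^+ b * (s ^+ 2) ^+ (c + d).
  by rewrite -!exprM -exprS -!exprD; congr (_ ^+ _); rewrite xE /m in aboveE *; lia.
transitivity ((-1) ^+ x * (s * (s ^+ 2) ^+ above val B x * s ^+ (m + d.*2 + x + 1))).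
  by ring.
by rewrite pow -sgn; ring.
Qed.

(** The complement of B minus x is the complement of B together with x, so a product over
    complements yields [kappa x] times a factor depending on B alone. *)
Lemma recolored_q_invariant k :
  q_invariant t val k (fun A => (\prod_(x in ~: A) kappa x) *: recolored_transfer A).
Proof.
move=> B _; rewrite -[RHS](scaler0 _ (\prod_(x in ~: B) kappa x)).
rewrite -[X in _ *: X](recolored_relation B) scaler_sumr; apply: eq_bigr => x xB.
have -> : ~: (B :\ x) = x |: ~: B by rewrite setCD setUC.
rewrite big_setU1 ?inE ?xB //= !scalerA; congr (_ *: _); ring.
Qed.

End Invariance.

(** * Comparing a cyclic segment of beads with its complement *)

Lemma sum_interval N a k : (a + k <= N)%N ->
  (\sum_(x < N | a <= x < a + k) x = 'C(k, 2) + k * a)%N.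
Proof.
move=> le_akN.
rewrite -(big_mkord (fun x => (a <= x < a + k)%N) id).
rewrite (@big_cat_nat _ _ _ a) //=; last by lia.
rewrite (@big_cat_nat _ _ _ (a + k) a) //=; last by lia.
rewrite big_nat_cond big_pred0 => [|x]; last by lia.
rewrite [X in (_ + (_ + X))%N]big_nat_cond [X in (_ + (_ + X))%N]big_pred0 => [|x]; last by lia.
rewrite add0n addn0 big_nat_cond (eq_bigl (fun x => (a <= x < a + k)%N && true)) => [|x].
  rewrite -big_nat_cond -{1}[a]add0n big_addn addKn big_split /= bin2_sum.
  by rewrite sum_nat_const_nat subn0.
by rewrite andbT andbb.
Qed.

Section Segment.

Variables (top bot : seq state) (N k a : nat).
Let p := size (site_labels top).
Hypotheses (NE : N = (p + size (site_labels bot))%N) (N2k : N = k.*2) (le_ak : (a <= k)%N).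

Definition segment : {set 'I_N} := [set x | (a <= val x < a + k)%N].
Local Notation U := segment.

Definition site_charge (x : 'I_N) : int := (bead_label top bot x)%:Z - (x < p)%N%:Z.

Definition swap_exponent : int :=
  \sum_(x in U) site_charge x - \sum_(x in ~: U) site_charge x + (k%:Z - a.*2%:Z).

Lemma card_segment : #|U| = k.
Proof.
have := @card_interval N a (a + k); rewrite leq_addr addKn => <-; last by lia.
by rewrite -sum1_card big_mkcond; apply: eq_bigr => x _; rewrite inE; case: ifP.
Qed.

Lemma card_segmentC : #|~: U| = k.
Proof. by have := cardsC U; rewrite card_segment card_ord; lia. Qed.

Lemma sum_segment : (\sum_(x in U) x = 'C(k, 2) + k * a)%N.
Proof. by rewrite -(@sum_interval N) ?N2k; [apply: eq_bigl => x; rewrite inE | lia]. Qed.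

Lemma sum_segmentC :
  (\sum_(x in U) x + \sum_(x in ~: U) x = k ^ 2 + 'C(k, 2) + 'C(k, 2))%N.
Proof.
rewrite -bin2_double -N2k -bin2_sum big_mkord [RHS](bigID (mem U)) /=; congr (_ + _)%N.
by apply: eq_bigl => x; rewrite inE.
Qed.

(** A label has the parity of the number of singletons to its right, so the charge of bead x is p -
    x modulo 2 and the sum is governed by the places. Evenness makes the final factor an integral
    power of t. *)
Lemma swap_exponent_even : exists j : int, swap_exponent = 2 * j.
Proof.
pose d (i : nat) := nth 0%N (doubles_right top ++ rev (doubles_right bot)) i.
pose m (x : 'I_N) : int := if (x < p)%N then (d x)%:Z - 1 else x%:Z - p%:Z + (d x)%:Z.
have chargeE (x : 'I_N) : site_charge x = p%:Z - x%:Z + 2 * m x.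
  rewrite /site_charge /m /d /bead_label !nth_cat size_doubles_right -/p.
  have lt_x := ltn_ord x; case: ltnP => lt_p.
    by rewrite nth_site_labels // -/p; lia.
  rewrite !nth_rev ?size_doubles_right; try lia.
  by rewrite nth_site_labels; lia.
have sumE (D : {set 'I_N}) : #|D| = k -> \sum_(x in D) site_charge x =
    k%:Z * p%:Z - (\sum_(x in D) x)%N%:Z + 2 * \sum_(x in D) m x.
  move=> cardD; rewrite (eq_bigr _ (fun x _ => chargeE x)) big_split sumrB /= -mulr_sumr.
  by rewrite sumr_const cardD (big_morph Posz PoszD (erefl _)) -[_ *+ k]mulr_natl natz.
rewrite /swap_exponent !sumE ?card_segment ?card_segmentC //.
exists (('C(k.+1, 2))%:Z - k%:Z * a%:Z - a%:Z + \sum_(x in U) m x - \sum_(x in ~: U) m x).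
move: (\sum_(x in U) m x) (\sum_(x in ~: U) m x) => mU mW.
move: (\sum_(x in U) x)%N (\sum_(x in ~: U) x)%N sum_segment sum_segmentC => SU SW -> sumUW.
have := bin2_square k; rewrite -!mulnn in sumUW *; rewrite binS bin1; lia.
Qed.

Section Swap.

Variables (F : fieldType) (K : comAlgType F) (s : F) (xs : seq K).
Hypotheses (s_neq0 : s != 0) (eq_size : size bot = size top).
Hypothesis qint_neq0 : forall m, \sum_(l < m.+1) (s ^+ 2)^-1 ^+ l != 0.
Lemma prod_kappa (D : {set 'I_N}) :
  \prod_(x in D) kappa s top bot x = (-1) ^+ (\sum_(x in D) x) *
   s ^+ (\sum_(x in D) bead_label top bot x + \sum_(x in D) x
         + \sum_(x in D) (p <= x)).
Proof. by rewrite big_split /= !prodrXr !big_split. Qed.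

Lemma recolored_swap :
  recolored_transfer s xs top bot U =
  s ^ swap_exponent *: recolored_transfer s xs top bot (~: U).
Proof.
have t_neq0 : s ^+ 2 != 0 by rewrite expf_neq0.
have lt_k (x : 'I_N) : (val x < k.*2)%N by rewrite -N2k ltn_ord.
have := cyclic_segment_swap t_neq0 qint_neq0 val_inj lt_k (eq_trans (card_ord N) N2k)
  (recolored_q_invariant xs s_neq0 eq_size NE (k := k)) le_ak.
rewrite /= -/U setCK !scalerA => swapU.
set c := (_ * \prod_(x in ~: U) _) in swapU.
have c_neq0 : c != 0.
  rewrite mulf_neq0 ?expf_neq0 //; apply/prodf_neq0 => x _.
  by rewrite mulf_neq0 ?expf_neq0 ?oppr_eq0 ?oner_eq0.
apply: (scalerI c_neq0); rewrite swapU scalerA; congr (_ *: _).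
have chargeE (D : {set 'I_N}) : #|D| = k -> \sum_(x in D) site_charge x =
   (\sum_(x in D) bead_label top bot x + \sum_(x in D) (p <= x))%N%:Z - k%:Z.
  move=> cardD; rewrite -[in RHS]cardD -sum1_card -!big_split /=.
  rewrite !(big_morph Posz PoszD (erefl _)) -sumrB; apply: eq_bigr => x _.
  by rewrite /site_charge; case: leqP => _ /=; lia.
rewrite /swap_exponent !chargeE ?card_segment ?card_segmentC // /c !prod_kappa.
move: (\sum_(x in U) bead_label _ _ x)%N (\sum_(x in ~: U) bead_label _ _ x)%N.
move: (\sum_(x in U) (p <= x))%N (\sum_(x in ~: U) (p <= x))%N.
move: (\sum_(x in U) x)%N (\sum_(x in ~: U) x)%N sum_segment sum_segmentC.
move=> SU SW -> sumUW TU TW LU LW.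
(* The places in the two blocks have sums differing by k^2 - 2ka. The signs of the two products of
   [kappa] hence differ by (-1)^k, which cancels the sign of the swap. *)
have sgn : (-1) ^+ SW = (-1) ^+ k * (-1) ^+ ('C(k, 2) + k * a) :> F.
  have -> : (-1) ^+ SW = (-1) ^+ (SW + (k * a).*2) :> F.
    by rewrite exprD -mul2n exprM sqrrN !expr1n mulr1.
  have -> : (SW + (k * a).*2 = k ^ 2 + ('C(k, 2) + k * a))%N by lia.
  by rewrite exprD -signr_odd oddX /= signr_odd.
rewrite sgn.
set e1 := (LU + _ + TU)%N; set e2 := (LW + SW + TW)%N; set z := (X in s ^ X).
have pow : (s ^+ 2) ^+ 'C(k.+1, 2) * s ^+ e1 = (s ^+ 2) ^+ (k.+1 * a) * s ^+ e2 * s ^ z.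
  rewrite -!exprM -!exprD !exprnP -expfzDr //; congr (s ^ _).
  have := bin2_square k; rewrite binS bin1 -mulnn /e1 /e2 /z => binE.
  by rewrite -mulnn in sumUW; lia.
transitivity ((-1) ^+ k * (-1) ^+ ('C(k, 2) + k * a) *
    ((s ^+ 2) ^+ 'C(k.+1, 2) * s ^+ e1)); first by ring.
by rewrite pow; ring.
Qed.

End Swap.

End Segment.

(** * Tableaux as chains of rows of particles *)

Local Open Scope nat_scope.

Lemma ltn_count_iota (P : pred nat) m i :
    (forall j, j.+1 < m -> P j.+1 -> P j) -> i < m ->
  (i < count P (iota 0 m)) = P i.
Proof.
elim: m i => // m IHm i P_down lt_im; rewrite -(addn1 m) iotaD count_cat /= addn0.
have IH := IHm _ (fun j lt_j => P_down j (ltnW lt_j)).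
have [Pm|nPm] := boolP (P m).
  have all_P j : j <= m -> P (m - j).
    elim: j => [|j IHj] lt_jm; first by rewrite subn0.
    by apply: P_down; first lia; rewrite subnSK // IHj // ltnW.
  have -> : count P (iota 0 m) = m.
    rewrite -[RHS](size_iota 0 m); apply/eqP; rewrite -all_count; apply/allP=> j.
    by rewrite mem_iota add0n => /ltnW le_jm; have := all_P _ (leq_subr j m); rewrite subKn.
  by rewrite addn1 lt_im; have := all_P _ (leq_subr i m); rewrite subKn // => ->.
rewrite addn0; move: lt_im; rewrite ltnS leq_eqVlt => /orP[/eqP->|/IH//].
by rewrite (negPf nPm) ltnNge -[X in count P _ <= X](size_iota 0 m) count_size.
Qed.

Lemma count_ltn_iota m h : count (fun i => i < h) (iota 0 m) = minn m h.
Proof.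
by elim: m => [|m IHm]; rewrite ?min0n // -(addn1 m) iotaD count_cat IHm /= addn0; lia.
Qed.

(** The occupied sites of the configuration that has f c particles at sites c and beyond;
    [suffix_count] is the inverse operation. *)
Definition bits_of (f : nat -> nat) a m : seq bool := [seq f c.+1 < f c | c <- iota a m].

Definition suffix_count (b : seq bool) c := count id (drop c b).

Lemma suffix_countS b c : c < size b ->
  suffix_count b c = nth false b c + suffix_count b c.+1.
Proof. by move=> lt_c; rewrite /suffix_count (drop_nth false). Qed.

Lemma suffix_count_bits f m c :
    (forall d, d < m -> f d.+1 <= f d <= (f d.+1).+1) -> f m = 0 -> c <= m ->
  suffix_count (bits_of f 0 m) c = f c.
Proof.
move=> f_slow fm le_cm; rewrite -(subKn le_cm); elim: (m - c) (leq_subr c m) => [|j IHj] lt_jm.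
  by rewrite subn0 /suffix_count drop_oversize ?size_map ?size_iota.
rewrite suffix_countS ?size_map ?size_iota; last by lia.
rewrite (nth_map 0) ?size_iota ?nth_iota; try lia.
have := f_slow (m - j.+1); rewrite -subSn // subSS => /(_ _)/andP[|]; first by lia.
by rewrite add0n (IHj (ltnW lt_jm)); case: (ltnP (f (m - j)) (f (m - j.+1))) => /=; lia.
Qed.

Fixpoint row_ok (h : bool) (b top : seq bool) : bool :=
  match b, top with
  | [::], [::] => ~~ h
  | v :: b', v' :: top' => if bit_step h v v' is Some h' then row_ok h' b' top' else false
  | _, _ => false
  end.

(** Paths only move right, so counts from a column on do not decrease from [b] to [top]. The count
    of [top] from c minus that of [b] from c+1 is the number of paths visiting column c, which is at
    most one. *)
Lemma row_okP (h : bool) b top :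
  reflect [/\ size b = size top, suffix_count top 0 = suffix_count b 0 + h &
     forall c, suffix_count b c <= suffix_count top c <= (suffix_count b c.+1).+1]
    (row_ok h b top).
Proof.
elim: b top h => [|v b IHb] [|v' top] h /=.
- by case: h; constructor; [case | split].
- by constructor=> -[].
- by constructor=> -[].
have zero u (s : seq bool) : suffix_count (u :: s) 0 = u + suffix_count s 0.
  by rewrite /suffix_count !drop0.
have succ u (s : seq bool) c : suffix_count (u :: s) c.+1 = suffix_count s c by [].
apply: (iffP idP) => [|[[eq_size] eq0 bnd]].
  case step: bit_step => [h'|] // /IHb[eq_size eq0 bnd]; split; rewrite ?eq_size //.
    by rewrite !zero eq0; have := bit_step_conserves step; lia.
  case=> [|c]; rewrite !succ // !zero eq0.
  by move: step; case: (h); case: (v); case: (v') => //= -[<-]; lia.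
have [h' step] : exists h', bit_step h v v' = Some h'.
  have := bnd 0; have := bnd 1; rewrite !zero !succ; rewrite !zero in eq0.
  move: eq0; case: (h); case: (v); case: (v') => //=; try (by eexists); lia.
rewrite step; apply/IHb; split=> // [|c]; last by have := bnd c.+1.
by move: eq0; rewrite !zero; have := bit_step_conserves step; lia.
Qed.

Fixpoint bit_seqs N : seq (seq bool) :=
  if N is N'.+1 then [seq v :: s | v <- [:: false; true], s <- bit_seqs N'] else [:: [::]].

Lemma mem_bit_seqs N s : (s \in bit_seqs N) = (size s == N).
Proof.
elim: N s => [|N IHN] s; first by rewrite inE -size_eq0.
apply/allpairsPdep/idP => [[v [u [_ uN ->]]]|]; first by rewrite /= eqSS -IHN.
case: s => // v s; rewrite /= eqSS -IHN => sN; exists v, s; split=> //.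
by case: v.
Qed.

Lemma uniq_bit_seqs N : uniq (bit_seqs N).
Proof.
elim: N => // N IHN; apply: allpairs_uniq => //.
by move=> [v s] [v' s'] _ _ /= [-> ->].
Qed.

Fixpoint chains n (b top : seq bool) : seq (seq (seq bool)) :=
  if n is n'.+1 then
    [seq b :: C | m <- [seq m <- bit_seqs (size b) | row_ok false b m], C <- chains n' m top]
  else if b == top then [:: [:: b]] else [::].

Lemma mem_chains n b top C :
  (C \in chains n b top) =
  [&& size C == n.+1, head [::] C == b, last [::] C == top & sorted (row_ok false) C].
Proof.
elim: n b C => [|n IHn] b C /=.
  case: C => [|c [|d C]] /=; last by case: ifP => _; rewrite ?in_nil ?inE //=; case: eqP.
    by case: ifP.
  case: ifP => [/eqP <-|]; rewrite ?inE.
    by rewrite eqseq_cons andbT; case: eqP => // ->; rewrite eqxx.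
  by move=> ne; rewrite in_nil andbT; apply/esym/negbTE; apply: contraFN ne => /andP[/eqP->].
apply/allpairsPdep/idP => [[m [D [mb DC ->]]]|].
  move: DC mb; rewrite mem_filter IHn => /and4P[/eqP sD /eqP <- /eqP <- srt] /andP[ok _].
  by case: D sD srt ok => //= d D [->] -> ->; rewrite !eqxx.
case: C => // c [|d C] //= /and4P[sC /eqP eq_c lC /andP[ok srt]].
exists d, (d :: C); rewrite -eq_c mem_filter ok IHn mem_bit_seqs.
have /row_okP[<- _ _] := ok; rewrite eqxx /= eqxx srt lC; split=> //.
by rewrite !andbT -eqSS.
Qed.

Lemma uniq_chains n b top : uniq (chains n b top).
Proof.
elim: n b => [|n IHn] b /=; first by case: ifP.
apply: allpairs_uniq_dep => [|m _|[m C] [m' C']]; rewrite ?filter_uniq ?uniq_bit_seqs //.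
move=> /allpairsPdep[x [y [_ xy [-> ->]]]] /allpairsPdep[x' [y' [_ xy' [-> ->]]]] [eq_y].
move: xy xy'; rewrite !mem_chains -eq_y.
by move=> /and4P[_ /eqP <- _ _] /and4P[_ /eqP <- _ _].
Qed.

Section Tableau.

Variables (n : nat) (S : skew_partition) (sh N : nat).
Implicit Type T : filling n S.

Let l := size (outer S).
Let inn i := part (inner S) i.+1.
Let out i := part (outer S) i.+1.

Lemma size_inner : size (inner S) = l.
Proof. by have := inner_sub_outer S; rewrite all2E => /andP[/eqP]. Qed.

Lemma inn_le_out i : inn i <= out i.
Proof.
have [lt_il|le_li] := ltnP i l; last by rewrite /inn /part nth_default ?size_inner.
have := inner_sub_outer S; rewrite all2E => /andP[_ /all_nthP-/(_ (0, 0) i)].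
by rewrite size_zip size_inner minnn nth_zip ?size_inner // => /(_ lt_il).
Qed.

Lemma part_nonincreasing s i : is_partition s -> part s i.+2 <= part s i.+1.
Proof.
move=> s_part; rewrite /part /=; have [lt_is|le_si] := ltnP i.+1 (size s).
  by apply: (sorted_ltn_nth (leT := geq)) => //; [move=> x y z /= h1 h2; apply: leq_trans h2 h1
    | rewrite inE ltnW].
by rewrite nth_default.
Qed.

Lemma mem_cells i j : ((i, j) \in cells S) =
  [&& 0 < i, i <= l & part (inner S) i < j <= part (outer S) i].
Proof.
apply/allpairsPdep/idP => [[i' [j' [ri ci [-> ->]]]]|/and3P[i0 il ij]].
  move: ri ci; rewrite !mem_iota => /andP[-> h1] /andP[h2 h3] /=.
  by have := inn_le_out i'.-1; rewrite /inn /out; case: i' h1 h2 h3 => //= i' *; lia.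
exists i, j; split=> //; first by rewrite mem_iota i0 add1n ltnS.
by rewrite mem_iota; lia.
Qed.

Definition letter_lt T (p : position) k : bool :=
  if insub p is Some x then T x < k else false.

Lemma letter_lt_val T x k : letter_lt T (val x) k = (T x < k).
Proof. by rewrite /letter_lt valK. Qed.

Lemma letter_lt_cell T p k : letter_lt T p k -> p \in cells S.
Proof. by rewrite /letter_lt; case: insubP. Qed.

(* The i-th path of the shape formed by the letters below k is at column c or
   further right; columns are shifted by sh to be natural numbers. *)
Definition covered T k i c : bool :=
  (c + i <= inn i + sh) || letter_lt T (i.+1, c + i - sh) k.

Definition tableau_height T k c := count (fun i => covered T k i c) (iota 0 l).

Definition partition_height (s : seq nat) c :=
  count (fun i => c + i <= part s i.+1 + sh) (iota 0 (size s)).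

Hypothesis le_l_sh : l <= sh.
Hypothesis out_lt_N : forall i, i < l -> out i + sh < N.

Lemma ltn_partition_height s i c : is_partition s -> i < size s ->
  (i < partition_height s c) = (c + i <= part s i.+1 + sh).
Proof.
move=> s_part lt_i; apply: (@ltn_count_iota (fun i => c + i <= part s i.+1 + sh)) => // j _.
by have := part_nonincreasing j s_part; lia.
Qed.

Section Semistandard.

Variable T : filling n S.
Hypothesis T_ss : semistandard T.

Lemma semistandard_row x y : (val x).1 = (val y).1 -> (val x).2 <= (val y).2 -> T x <= T y.
Proof.
move=> eq1; rewrite leq_eqVlt => /orP[/eqP eq2|lt2].
  suff -> : x = y by [].
  by apply: val_inj; rewrite [LHS]surjective_pairing [RHS]surjective_pairing eq1 eq2.
have /forallP/(_ x)/forallP/(_ y)/andP[/implyP row _] := T_ss.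
by rewrite -ltnS; apply: row; rewrite eq1 eqxx lt2.
Qed.

Lemma semistandard_col x y : (val x).2 = (val y).2 -> (val x).1 < (val y).1 -> T x < T y.
Proof.
move=> eq2 lt1.
have /forallP/(_ x)/forallP/(_ y)/andP[_ /implyP col] := T_ss.
by rewrite -ltnS; apply: col; rewrite eq2 eqxx lt1.
Qed.

Lemma covered_left k i c : covered T k i c.+1 -> covered T k i c.
Proof.
case/orP=> [le_c|lt_k]; first by apply/orP; left; lia.
apply/orP; case: (leqP (c + i) (inn i + sh)) => [|gt_c]; [by left|right].
have := letter_lt_cell lt_k; rewrite mem_cells => /and3P[_ il /andP[_ le_out]].
have cell : (i.+1, c + i - sh) \in cells S.
  by rewrite mem_cells /= il /=; rewrite /inn in gt_c; lia.
move: lt_k; rewrite /letter_lt; case: insubP => // y _ yE.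
case: insubP => [x _ xE|]; last by rewrite cell.
by apply: leq_ltn_trans; apply: semistandard_row; rewrite xE yE //=; lia.
Qed.

Lemma covered_up k i c : covered T k.+1 i.+1 c -> covered T k i c.+1.
Proof.
(* Path i+1 at column c and path i at column c+1 refer to the same column of the diagram, where
   strict increase lowers the bound on the letter by one. *)
have inn_dec := part_nonincreasing i (inner_partition S).
have out_dec := part_nonincreasing i (outer_partition S).
case/orP=> [le_c|lt_k]; first by apply/orP; left; move: inn_dec le_c; rewrite /inn; lia.
apply/orP; case: (leqP (c.+1 + i) (inn i + sh)) => [|gt_c]; [by left|right].
have := letter_lt_cell lt_k; rewrite mem_cells => /and3P[_ il /andP[_ le_out]].
have cell : (i.+1, c.+1 + i - sh) \in cells S.
  by rewrite mem_cells /= (ltnW il) /=; rewrite /inn in gt_c; lia.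
move: lt_k; rewrite /letter_lt; case: insubP => // y _ yE.
case: insubP => [x _ xE|]; last by rewrite cell.
by rewrite ltnS; apply: leq_trans; apply: semistandard_col; rewrite xE yE //=; lia.
Qed.

Lemma covered_mono k i c : covered T k i c -> covered T k.+1 i c.
Proof.
case/orP=> [le_c|]; first by apply/orP; left.
by rewrite /covered /letter_lt; case: insub => // x /ltnW lt; rewrite ltnS lt orbT.
Qed.

Lemma ltn_tableau_height k i c : i < l -> (i < tableau_height T k c) = covered T k i c.
Proof.
move=> lt_i; apply: (@ltn_count_iota (fun i => covered T k i c)) => // j _ cov.
exact/covered_left/covered_up/covered_mono.
Qed.

Lemma tableau_height_le k c : tableau_height T k c <= l.
Proof. by rewrite -[X in _ <= X](size_iota 0) count_size. Qed.

Lemma height_left k c : tableau_height T k c.+1 <= tableau_height T k c.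
Proof. by apply: sub_count => i; apply: covered_left. Qed.

Lemma height_mono k c : tableau_height T k c <= tableau_height T k.+1 c.
Proof. by apply: sub_count => i; apply: covered_mono. Qed.

Lemma height_up k c : tableau_height T k.+1 c <= (tableau_height T k c.+1).+1.
Proof.
rewrite leqNgt; apply/negP=> lt_h.
have lt_l := leq_trans lt_h (tableau_height_le k.+1 c).
move: (lt_h); rewrite ltn_tableau_height // => /covered_up.
by rewrite -ltn_tableau_height ?ltnn // ltnW.
Qed.

Lemma height_slow k c : tableau_height T k c <= (tableau_height T k c.+1).+1.
Proof. exact: leq_trans (height_mono k c) (height_up k c). Qed.

End Semistandard.

Lemma height0 T c : tableau_height T 0 c = partition_height (inner S) c.
Proof.
rewrite /partition_height size_inner; apply: eq_count => i; rewrite /covered /letter_lt.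
by case: insub => [x|]; rewrite ?ltn0 orbF.
Qed.

Lemma height_last T c : tableau_height T n c = partition_height (outer S) c.
Proof.
apply: eq_in_count => i; rewrite mem_iota /= add0n => lt_i; rewrite /covered /letter_lt.
have := inn_le_out i; rewrite -/(out i).
case: insubP => [x + _|]; rewrite ?ltn_ord ?orbT ?orbF mem_cells /= lt_i -/(inn i) -/(out i); lia.
Qed.

Lemma height_N T k : tableau_height T k N = 0.
Proof.
apply/eqP; rewrite -leqn0 leqNgt -has_count; apply/hasPn => i.
rewrite mem_iota /= add0n => lt_i; have := out_lt_N lt_i; have := inn_le_out i.
move=> le_io lt_o; rewrite negb_or; apply/andP; split; first by lia.
by apply: contraL lt_o => /letter_lt_cell; rewrite mem_cells /= -/(out i); lia.
Qed.

Lemma height_0 T k : tableau_height T k 0 = l.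
Proof.
rewrite -[RHS](size_iota 0); apply/eqP; rewrite -all_count; apply/allP => i.
by rewrite mem_iota /covered; lia.
Qed.

Definition tableau_chain T : seq (seq bool) :=
  mkseq (fun k => bits_of (tableau_height T k) 0 N) n.+1.

Definition partition_bits s := bits_of (partition_height s) 0 N.

Lemma suffix_count_height T k c : semistandard T -> c <= N ->
  suffix_count (bits_of (tableau_height T k) 0 N) c = tableau_height T k c.
Proof.
move=> T_ss le_cN; apply: suffix_count_bits; rewrite ?height_N // => d _.
by rewrite height_left // height_slow.
Qed.

Lemma tableau_chain_mem T : semistandard T ->
  tableau_chain T \in chains n (partition_bits (inner S)) (partition_bits (outer S)).
Proof.
move=> T_ss; rewrite mem_chains size_mkseq eqxx andTb; apply/and3P; split.
- by apply/eqP/eq_map => c; rewrite !height0.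
- rewrite -nth_last size_mkseq nth_mkseq //=.
  by apply/eqP/eq_map => c; rewrite !height_last.
apply/(sortedP [::]) => k; rewrite size_mkseq => lt_kn.
rewrite !nth_mkseq // ?(ltnW lt_kn) //; apply/row_okP; split.
- by rewrite !size_map.
- by rewrite !suffix_count_height // !height_0 addn0.
move=> c; have [lt_c|le_c] := ltnP c N.
  by rewrite !suffix_count_height ?(ltnW lt_c) // height_mono height_up.
by rewrite /suffix_count !drop_oversize ?size_map ?size_iota // ltnW.
Qed.

(** The cell (i+1, j) has a letter below k exactly when i is less than the height at column j + sh -
    i, so the heights determine all letters. *)
Lemma tableau_chain_inj T T' : semistandard T -> semistandard T' ->
  tableau_chain T = tableau_chain T' -> T = T'.
Proof.
move=> ssT ssT' eqC; apply/ffunP => x; apply: val_inj.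
have eqH k c : k <= n -> c <= N -> tableau_height T k c = tableau_height T' k c.
  move=> le_k le_c; rewrite -!suffix_count_height //; congr suffix_count.
  by have := congr1 (fun C => nth [::] C k) eqC; rewrite !nth_mkseq.
have eqL k : k <= n -> (T x < k) = (T' x < k).
  move=> le_k; rewrite -!letter_lt_val; case xE : (val x) => [i j].
  have := valP x; rewrite xE mem_cells; case: i xE => // i xE /and3P[_ lt_i /andP[lt_j le_j]].
  have lt_oN := out_lt_N lt_i.
  have jE : j = j + sh - i + i - sh by lia.
  have covE T1 : letter_lt T1 (i.+1, j) k = covered T1 k i (j + sh - i).
    by rewrite /covered -jE leqNgt (_ : _ < _) //=; rewrite /inn; lia.
  rewrite !covE -!ltn_tableau_height // eqH //.
  by rewrite /out in lt_oN; lia.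
have := eqL (T x).+1 (ltn_ord _); have := eqL (T' x).+1 (ltn_ord _).
by rewrite !ltnS !leqnn => le1 le2; apply/eqP; rewrite eqn_leq le1 -le2.
Qed.


Lemma partition_height_left s c : partition_height s c.+1 <= partition_height s c.
Proof. by apply: sub_count => i /=; lia. Qed.

Lemma partition_height_slow s c : is_partition s ->
  partition_height s c <= (partition_height s c.+1).+1.
Proof.
move=> s_part; rewrite leqNgt; apply/negP=> lt_h.
have le_s : partition_height s c <= size s by rewrite -[X in _ <= X](size_iota 0) count_size.
have lt_s := leq_trans lt_h le_s.
move: (lt_h); rewrite ltn_partition_height // => le_c.
have := ltn_partition_height c.+1 s_part (ltnW lt_s); rewrite ltnn => /esym/negbT.
by have := part_nonincreasing (partition_height s c.+1) s_part; lia.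
Qed.

Lemma suffix_count_partition s c : is_partition s ->
    (forall i, i < size s -> part s i.+1 + sh < N) -> c <= N ->
  suffix_count (partition_bits s) c = partition_height s c.
Proof.
move=> s_part lt_N le_cN; apply: suffix_count_bits => //.
  by move=> d _; rewrite partition_height_left partition_height_slow.
apply/eqP; rewrite -leqn0 leqNgt -has_count; apply/hasPn => i.
by rewrite mem_iota => /= lt_i; have := lt_N i lt_i; lia.
Qed.

Lemma tableau_chain_surj C : 0 < n ->
    C \in chains n (partition_bits (inner S)) (partition_bits (outer S)) ->
  exists2 T, semistandard T & tableau_chain T = C.
Proof.
move=> n_gt0; rewrite mem_chains => /and4P[/eqP sizeC /eqP headC /eqP lastC].
move=> /(sortedP [::]) okC; rewrite sizeC in okC.
pose H k c := suffix_count (nth [::] C k) c.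
have sizeCk k : k <= n -> size (nth [::] C k) = N.
  elim: k => [_|k IHk lt_k]; first by rewrite nth0 headC size_map size_iota.
  by have /row_okP[<- _ _] := okC k lt_k; rewrite IHk // ltnW.
have Hstep k c : k < n -> H k c <= H k.+1 c <= (H k c.+1).+1.
  by move=> lt_k; have /row_okP[_ _] := okC k lt_k; apply.
have Hmono k k' c : k <= k' -> k' <= n -> H k c <= H k' c.
  move=> le_kk'; rewrite -(subnKC le_kk'); elim: (k' - k) => [|d IHd]; first by rewrite addn0.
  rewrite addnS => lt_n; have /andP[le1 _] := Hstep _ c lt_n.
  by apply: leq_trans le1; apply: IHd; apply: ltnW.
have Hleft k c : H k c.+1 <= H k c.
  rewrite /H /suffix_count; case: (ltnP c (size (nth [::] C k))) => [lt_c|le_c].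
    by rewrite (drop_nth false lt_c) /= leq_addl.
  by rewrite !drop_oversize // ltnW.
have Hslow k c d : H k c <= H k (c + d) + d.
  elim: d => [|d IHd]; first by rewrite !addn0.
  apply: leq_trans IHd _; rewrite [c + d.+1]addnS -[_ + d.+1]addSnnS leq_add2r.
  rewrite /H /suffix_count; case: (ltnP (c + d) (size (nth [::] C k))) => [lt_c|le_c].
    by rewrite (drop_nth false lt_c) /=; case: (nth _ _ _).
  by rewrite !drop_oversize // ltnW.
have Hdown k c d : H k (c + d) <= H k c.
  elim: d => [|d IHd]; first by rewrite addn0.
  by rewrite addnS; apply: leq_trans IHd.
have H0 c : c <= N -> H 0 c = partition_height (inner S) c.
  move=> le_c; rewrite /H nth0 headC suffix_count_partition //; first exact: inner_partition.
  move=> i; rewrite size_inner => lt_i.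
  by apply: leq_ltn_trans (out_lt_N lt_i); rewrite leq_add2r inn_le_out.
have Hn c : c <= N -> H n c = partition_height (outer S) c.
  move=> le_c; rewrite /H -[n]/(n.+1.-1) -sizeC nth_last lastC suffix_count_partition //.
  exact: outer_partition.
(* The letter of a cell is the number of stages k = 1, ..., n-1 at which the cell is not yet
   covered. Stage n covers every cell, and leaving it out keeps the value below n. *)
pose cnt (p : position) :=
  count (fun k => H k.+1 (p.2 + sh - p.1.-1) < p.1) (iota 0 n.-1).
have cnt_lt p : cnt p < n.
  by rewrite -[X in _ < X](prednK n_gt0) ltnS -[X in _ <= X](size_iota 0) count_size.
have cntE i j k : (i.+1, j) \in cells S -> k <= n ->
    (cnt (i.+1, j) < k) = (i < H k (j + sh - i)).
  rewrite mem_cells /= => /andP[lt_i /andP[lt_j le_j]] le_kn.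
  have lt_oN := out_lt_N lt_i.
  have le_cN : j + sh - i <= N by move: lt_oN; rewrite /out; lia.
  case: k le_kn => [_|k le_kn].
    rewrite ltn0 H0 // ltn_partition_height ?size_inner //; last exact: inner_partition.
    by apply/esym/negbTE; lia.
  case: (ltngtP k.+1 n) le_kn => // [lt_kn _|eq_kn _].
    rewrite ltnS leqNgt [k < _]ltn_count_iota /=; [by rewrite -leqNgt| |by lia].
    move=> k' lt_k'; apply: leq_ltn_trans; apply: Hmono => //; lia.
  rewrite eq_kn cnt_lt Hn // ltn_partition_height //; last exact: outer_partition.
  by apply/esym; lia.
pose T : filling n S := [ffun x => Ordinal (cnt_lt (val x))].
have letterE i j k : (i.+1, j) \in cells S -> k <= n ->
    letter_lt T (i.+1, j) k = (i < H k (j + sh - i)).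
  move=> cell le_k; rewrite -cntE // /letter_lt.
  by case: insubP => [x _ xE|]; rewrite ?cell // ffunE /= xE.
have coveredE i c k : i < l -> k <= n -> c <= N -> covered T k i c = (i < H k c).
  move=> lt_i le_k le_c; rewrite /covered; case: (leqP (c + i) (inn i + sh)) => [le_ci|lt_ci] /=.
    have lt_i0 : i < H 0 c.
      by rewrite H0 // (ltn_partition_height _ (inner_partition S)) ?size_inner.
    by rewrite (leq_trans lt_i0 (Hmono 0 k c (leq0n _) le_k)).
  have [le_co|lt_oc] := leqP (c + i) (out i + sh).
    rewrite letterE //; last by rewrite mem_cells /= lt_i; move: lt_ci le_co; rewrite /inn /out; lia.
    by congr (_ < H _ _); lia.
  have -> : (i < H k c) = false.
    apply/negbTE; rewrite -leqNgt; apply: leq_trans (Hmono k n c le_k (leqnn n)) _.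
    rewrite Hn // leqNgt ltn_partition_height //; last exact: outer_partition.
    by rewrite -ltnNge.
  apply/negbTE; apply: contraL lt_oc => /letter_lt_cell.
  by rewrite mem_cells /= -/(out i); lia.
exists T.
  apply/forallP=> x; apply/forallP=> y.
  case xE : (val x) (valP x) => [i j] xcell; case yE : (val y) (valP y) => [i' j'] ycell.
  move: (xcell) (ycell); rewrite !mem_cells => /and3P[i_gt0 le_i /andP[ij ij']].
  move=> /and3P[i'_gt0 le_i' /andP[i'j i'j']].
  case: i i_gt0 xE xcell le_i ij ij' => // i _ xE xcell le_i ij ij'.
  case: i' i'_gt0 yE ycell le_i' i'j i'j' => // i' _ yE ycell le_i' i'j i'j'.
  have cntx k : k <= n -> (T x < k) = (i < H k (j + sh - i)).
    by move=> le_k; rewrite -letterE // -xE letter_lt_val.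
  have cnty k : k <= n -> (T y < k) = (i' < H k (j' + sh - i')).
    by move=> le_k; rewrite -letterE // -yE letter_lt_val.
  apply/andP; split; apply/implyP=> /andP[/eqP /= eq1 lt2].
    rewrite /value ltnS -ltnS cntx // ; have := cnty _ (ltn_ord (T y)).
    rewrite ltnSn => /esym; case: eq1 => <- lt_i; apply: leq_trans lt_i _.
    have -> : j' + sh - i = j + sh - i + (j' - j) by lia.
    exact: Hdown.
  rewrite /value ltnS cntx ?(ltnW (ltn_ord _)) //.
  have := cnty _ (ltn_ord (T y)); rewrite ltnSn => /esym lt_i'.
  (* Undoing one stage moves one column to the right and loses at most one path; the other i' - i -
     1 rows are bridged by [Hslow]. *)
  have /andP[_ le_h] := Hstep (T y) (j' + sh - i') (ltn_ord _).
  have := Hslow (T y) (j' + sh - i').+1 (i' - i.+1).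
  have -> : (j' + sh - i').+1 + (i' - i.+1) = j + sh - i by lia.
  by lia.
apply: (@eq_from_nth _ [::]); rewrite size_mkseq ?sizeC // => k lt_k.
rewrite nth_mkseq //; apply: (@eq_from_nth _ false); rewrite size_map size_iota ?sizeCk // => c lt_c.
have heightE d : d <= N -> tableau_height T k d = H k d.
  move=> le_d; rewrite /tableau_height (eq_in_count (a2 := fun i => i < H k d)) => [|i].
    rewrite count_ltn_iota; apply/minn_idPr.
    apply: leq_trans (Hmono k n d lt_k (leqnn n)) _; rewrite Hn //.
    by rewrite -[X in _ <= X](size_iota 0) count_size.
  by rewrite mem_iota => /= lt_i; rewrite coveredE.
rewrite (nth_map 0) ?size_iota // nth_iota // add0n !heightE ?(ltnW lt_c) //.
have := @suffix_countS (nth [::] C k) c; rewrite sizeCk // => /(_ lt_c).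
by rewrite -!/(H k _) => ->; case: (nth _ _ c); rewrite ?add0n ?add1n ?ltnn ?ltnSn.
Qed.

End Tableau.

Lemma sum_tableaux (V : nmodType) n S sh N (phi : seq (seq bool) -> V) :
    0 < n -> size (outer S) <= sh ->
    (forall i, i < size (outer S) -> part (outer S) i.+1 + sh < N) ->
  (\sum_(T : filling n S | semistandard T) phi (tableau_chain sh N T) =
   \sum_(C <- chains n (partition_bits sh N (inner S)) (partition_bits sh N (outer S))) phi C)%R.
Proof.
move=> n_gt0 le_sh lt_N; pose ss := enum [pred T : filling n S | semistandard T].
have mem_ss T : (T \in ss) = semistandard T by rewrite mem_enum inE.
rewrite -big_enum -/ss -(big_map (tableau_chain sh N) xpredT).
apply: perm_big; apply: uniq_perm (uniq_chains _ _ _) _ => [|C].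
  rewrite map_inj_in_uniq ?enum_uniq // => T T'; rewrite !mem_ss => T_ss T'_ss.
  exact: tableau_chain_inj.
apply/mapP/idP => [[T]|/tableau_chain_surj[] // T T_ss <-].
  by rewrite mem_ss => T_ss ->; apply: tableau_chain_mem.
by exists T; rewrite ?mem_ss.
Qed.

(** * Pairs of chains and the transfer matrix *)

Section ChainWeight.

Variables (K : comNzRingType) (t : K).
Local Open Scope ring_scope.

Fixpoint chain_weight (xs : seq K) (C1 C2 : seq (seq bool)) : K :=
  if xs is x :: xs' then
    row_weight t x (false, false) (zip (head [::] C1) (head [::] C2))
      (zip (head [::] (behead C1)) (head [::] (behead C2)))
    * chain_weight xs' (behead C1) (behead C2)
  else 1.

Lemma chain_weightE xs C1 C2 : chain_weight xs C1 C2 =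
  \prod_(k < size xs) row_weight t (nth 0 xs k) (false, false)
    (zip (nth [::] C1 k) (nth [::] C2 k)) (zip (nth [::] C1 k.+1) (nth [::] C2 k.+1)).
Proof.
elim: xs C1 C2 => [|x xs IHxs] C1 C2 /=; first by rewrite big_ord0.
rewrite big_ord_recl IHxs !nth0 -!nth_behead !nth0; congr (_ * _).
by apply: eq_bigr => k _; rewrite !nth_behead.
Qed.

Lemma row_weight_ok x h b1 b2 m1 m2 :
    size b1 = size b2 -> size m1 = size b1 -> size m2 = size b2 ->
    row_weight t x h (zip b1 b2) (zip m1 m2) != 0 -> row_ok h.1 b1 m1 && row_ok h.2 b2 m2.
Proof.
elim: b1 b2 m1 m2 h => [|v1 b1 IHb] [|v2 b2] [|u1 m1] [|u2 m2] [h1 h2] //=.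
  by move=> _ _ _; case: h1; case: h2; rewrite /= ?eqxx.
move=> [sb] [s1] [s2]; case: bit_step => [i|]; last by rewrite eqxx.
case: bit_step => [j|]; last by rewrite eqxx.
have [eq0|ne0 _] := eqVneq (row_weight t x (i, j) (zip b1 b2) (zip m1 m2)) 0.
  by rewrite eq0 mulr0 eqxx.
exact: (IHb b2 m1 m2 (i, j)).
Qed.

Lemma sum_bit_seqsS N (phi : seq bool -> K) :
  \sum_(m <- bit_seqs N.+1) phi m =
  \sum_(m <- bit_seqs N) phi (false :: m) + \sum_(m <- bit_seqs N) phi (true :: m).
Proof. by rewrite /= cats0 big_cat !big_map. Qed.

Lemma sum_zip_bits N (phi : seq state -> K) :
  \sum_(m1 <- bit_seqs N) \sum_(m2 <- bit_seqs N) phi (zip m1 m2) =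
  \sum_(m <- state_seqs N) phi m.
Proof.
elim: N phi => [|N IHN] phi; first by rewrite !big_seq1.
rewrite sum_bit_seqsS; under eq_bigr do rewrite sum_bit_seqsS.
under [X in _ + X]eq_bigr do rewrite sum_bit_seqsS.
rewrite !big_split (IHN (fun m => phi (_ :: m))) (IHN (fun m => phi ((false, true) :: m))).
rewrite (IHN (fun m => phi ((true, false) :: m))) (IHN (fun m => phi ((true, true) :: m))).
by rewrite /= cats0 !big_cat !big_map /= !addrA.
Qed.

(** [transfer] runs over all intermediate states and [chains] only over steps legal for each colour;
    by [row_weight_ok] the other states have weight zero. *)
Lemma sum_chain_weight xs b1 b2 top1 top2 :
    size b2 = size b1 -> size top1 = size b1 -> size top2 = size b1 ->
  \sum_(C1 <- chains (size xs) b1 top1) \sum_(C2 <- chains (size xs) b2 top2)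
     chain_weight xs C1 C2 =
  transfer t xs (zip b1 b2) (zip top1 top2).
Proof.
elim: xs b1 b2 => [|x xs IHxs] b1 b2 sb2 s1 s2 /=.
  have -> : (zip b1 b2 == zip top1 top2) = (b1 == top1) && (b2 == top2).
    apply/eqP/andP => [eqz|[/eqP-> /eqP->]] //.
    by rewrite -(unzip1_zip (s := b1) (t := b2)) ?sb2 // eqz unzip1_zip ?s1 ?s2 //
      -[b2](unzip2_zip (s := b1)) ?sb2 // eqz unzip2_zip ?s1 ?s2.
  by case: eqP => _; case: eqP => _; rewrite /= ?big_seq1 ?big_nil //; rewrite big1.
rewrite size_zip sb2 minnn -sum_zip_bits big_allpairs_dep /= big_filter big_mkcond.
apply: eq_big_seq => m1; rewrite mem_bit_seqs => /eqP sm1.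
have zero_weight m2 : size m2 = size b1 -> ~~ (row_ok false b1 m1 && row_ok false b2 m2) ->
    row_weight t x (false, false) (zip b1 b2) (zip m1 m2) = 0.
  move=> sm2; apply: contraNeq => /row_weight_ok; apply; rewrite ?sb2 //.
under [RHS]eq_big_seq => m2.
  rewrite mem_bit_seqs => /eqP sm2.
  rewrite -IHxs ?sm1 ?sm2 // mulr_sumr; over.
have [ok1|nok1] := ifPn; last first.
  rewrite big_seq big1 // => m2; rewrite mem_bit_seqs => /eqP sm2.
  by apply: big1 => C1 _; rewrite zero_weight ?mul0r // (negPf nok1).
rewrite [RHS]exchange_big /=; apply: eq_big_seq => C1.
rewrite mem_chains => /and4P[_ /eqP hC1 _ _].
rewrite big_allpairs_dep /= big_filter big_mkcond; apply: eq_big_seq => m2.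
rewrite mem_bit_seqs => /eqP sm2.
have [ok2|nok2] := ifPn; last by rewrite zero_weight ?mul0r // (negPf nok2) andbF.
rewrite mulr_sumr; apply: eq_big_seq => C2; rewrite mem_chains => /and4P[_ /eqP hC2 _ _].
by rewrite hC1 hC2.
Qed.

End ChainWeight.

Definition interlaced (f g : nat -> nat) c :=
  (f c.+1 <= f c <= g c) && (g c.+1 <= g c <= (f c.+1).+1) && (f c.+1 <= g c.+1).

(** With f and g the heights below and above the row, g c - f c counts the paths entering column c
    from the left. *)
Lemma bit_step_heights f g c : interlaced f g c ->
  bit_step (f c < g c) (f c.+1 < f c) (g c.+1 < g c) = Some (f c.+1 < g c.+1).
Proof.
rewrite /interlaced /bit_step.
by case: (ltnP (f c) (g c)); case: (ltnP (f c.+1) (f c)); case: (ltnP (g c.+1) (g c));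
  case: (ltnP (f c.+1) (g c.+1)) => //=; lia.
Qed.

(** The factor [g2 c - f2 c.+1] is 1 if a red path visits column c and 0 otherwise, whether it comes
    from the left or from below. *)
Lemma row_weight_heights (K : comNzRingType) (t x : K) f1 g1 f2 g2 a m :
    (forall c, a <= c < a + m -> interlaced f1 g1 c) ->
    (forall c, a <= c < a + m -> interlaced f2 g2 c) ->
    g1 (a + m) = f1 (a + m) -> g2 (a + m) = f2 (a + m) ->
  (row_weight t x (f1 a < g1 a, f2 a < g2 a)%N
     (zip (bits_of f1 a m) (bits_of f2 a m)) (zip (bits_of g1 a m) (bits_of g2 a m)) =
   x ^+ (\sum_(a <= c < a + m) (g1 c.+1 - f1 c.+1 + (g2 c.+1 - f2 c.+1)))%N
   * t ^+ (\sum_(a <= c < a + m) (g1 c.+1 - f1 c.+1) * (g2 c - f2 c.+1))%N)%R.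
Proof.
elim: m a => [|m IHm] a il1 il2.
  by rewrite !addn0 => -> ->; rewrite !big_geq // !ltnn /= !GRing.mulr1.
rewrite addnS => end1 end2.
have i1 : interlaced f1 g1 a by apply: il1; lia.
have i2 : interlaced f2 g2 a by apply: il2; lia.
rewrite /= !bit_step_heights // IHm; last 4 first.
- by move=> c lt_c; apply: il1; lia.
- by move=> c lt_c; apply: il2; lia.
- by rewrite addSn.
- by rewrite addSn.
have lt_a : a < (a + m).+1 by rewrite ltnS leq_addr.
rewrite !addSn !(big_ltn lt_a).
have e1 : (f1 a.+1 < g1 a.+1 : nat) = g1 a.+1 - f1 a.+1.
  by move: i1; rewrite /interlaced; case: (ltnP (f1 a.+1) (g1 a.+1)) => /=; lia.
have e2 : (f2 a.+1 < g2 a.+1 : nat) = g2 a.+1 - f2 a.+1.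
  by move: i2; rewrite /interlaced; case: (ltnP (f2 a.+1) (g2 a.+1)) => /=; lia.
have e3 : ((f2 a < g2 a) || (f2 a.+1 < f2 a) : nat) = g2 a - f2 a.+1.
  move: i2; rewrite /interlaced; case: (ltnP (f2 a) (g2 a)) => /=; first by lia.
  by case: (ltnP (f2 a.+1) (f2 a)) => /=; lia.
by rewrite -mulnb e1 e2 e3 !GRing.exprD; ring.
Qed.

Lemma count_diff (I : Type) (P Q : pred I) (s : seq I) : (forall i, P i -> Q i) ->
  count Q s - count P s = count (fun i => Q i && ~~ P i) s.
Proof.
move=> PQ; elim: s => //= i s <-; have := sub_count PQ s.
by move: (PQ i); case: (P i) => [->//|_]; case: (Q i) => /=; lia.
Qed.

(** * Multiplicities and coinversions as differences of heights *)

Section Cells.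

Variables (n : nat) (S : skew_partition) (sh N : nat).
Let l := size (outer S).
Let inn i := part (inner S) i.+1.
Let out i := part (outer S) i.+1.
Hypothesis le_l_sh : l <= sh.
Hypothesis out_lt_N : forall i, i < l -> out i + sh < N.

(** Row i+1 has a cell of content c - sh. Path i crosses this cell as it steps from shifted column c
    to c+1. *)
Definition cell_at i c : bool := inn i + sh < c.+1 + i <= out i + sh.

Lemma sum_seq_sub (G : position -> nat) :
  \sum_(x : seq_sub (cells S)) G (val x) = \sum_(p <- cells S) G p.
Proof.
have uniq_cells : uniq (cells S).
  by apply: allpairs_uniq_dep => [|i _|[i j] [i' j'] _ _ [-> ->] //]; apply: iota_uniq.
rewrite -big_enum -(big_map val xpredT); apply: perm_big; apply: uniq_perm => // [|p].
  by rewrite map_inj_uniq ?enum_uniq //; apply: val_inj.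
apply/mapP/idP => [[x _ ->]|pS]; first exact: valP.
by exists (SeqSub pS); rewrite ?mem_enum.
Qed.

Lemma sum_cells (G : position -> nat) :
  \sum_(p <- cells S) G p =
  \sum_(i <- iota 0 l) \sum_(0 <= c < N) if cell_at i c then G (i.+1, c.+1 + i - sh) else 0.
Proof.
rewrite big_allpairs_dep /= /rows -[1]addn0 iotaDl big_map.
apply: eq_big_seq => i; rewrite mem_iota add0n => /andP[_ lt_i]; rewrite add1n.
have := inn_le_out S i; rewrite -/(inn i) -/(out i) => le_io; have lt_oN := out_lt_N lt_i.
rewrite -(big_mkcond (cell_at i)) /=.
have -> : iota (inn i).+1 (out i - inn i) =
    [seq c.+1 + i - sh | c <- index_iota 0 N & cell_at i c].
  have -> : [seq c <- index_iota 0 N | cell_at i c] = iota (inn i + sh - i) (out i - inn i).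
    apply: (irr_sorted_eq (leT := ltn)) => //; first exact: ltn_trans.
    - by move=> x; rewrite /= ltnn.
    - exact/sorted_filter/iota_ltn_sorted/ltn_trans.
    - exact: iota_ltn_sorted.
    by move=> c; rewrite mem_filter mem_index_iota mem_iota /cell_at; lia.
  apply: (@eq_from_nth _ 0); rewrite ?size_map !size_iota // => c lt_c.
  by rewrite (nth_map 0) ?size_iota // !nth_iota //; lia.
by rewrite big_map big_filter.
Qed.



Implicit Type T : filling n S.

Definition letter_eq T (p : position) k : bool :=
  if insub p is Some x then T x == k :> nat else false.

Lemma letter_eq_val T x k : letter_eq T (val x) k = (T x == k :> nat).
Proof. by rewrite /letter_eq valK. Qed.

Lemma cell_letter_eq T k i c : i < l ->
  cell_at i c && letter_eq T (i.+1, c.+1 + i - sh) k =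
  covered sh T k.+1 i c.+1 && ~~ covered sh T k i c.+1.
Proof.
move=> lt_i; rewrite /covered /cell_at -/(inn i) ltnNge.
case: (leqP (c.+1 + i) (inn i + sh)) => [//|lt_c] /=.
case: (leqP (c.+1 + i) (out i + sh)) => [le_c|gt_c] /=.
  rewrite /letter_eq /letter_lt; case: insubP => // x _ _.
  by rewrite -leqNgt ltnS eqn_leq.
have -> : letter_lt T (i.+1, c.+1 + i - sh) k.+1 = false => //.
by apply/negbTE; apply: contraL gt_c => /letter_lt_cell; rewrite mem_cells /= -/(out i); lia.
Qed.

Lemma multiplicityE T (k : 'I_n) : semistandard T ->
  multiplicity T k =
  \sum_(0 <= c < N) (tableau_height sh T k.+1 c.+1 - tableau_height sh T k c.+1).
Proof.
move=> T_ss; transitivity (\sum_(x : seq_sub (cells S)) (letter_eq T (val x) k : nat)).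
  rewrite /multiplicity -sum1dep_card big_mkcond; apply: eq_bigr => x _.
  by rewrite letter_eq_val -val_eqE; case: eqP.
rewrite (sum_seq_sub (fun p => letter_eq T p k : nat)) sum_cells exchange_big /=.
apply: eq_bigr => c _; rewrite count_diff => [|i]; last exact: covered_mono.
rewrite -sum1_count [RHS]big_mkcond; apply: eq_big_seq => i; rewrite mem_iota => /= lt_i.
by rewrite -cell_letter_eq //; case: cell_at => //; case: letter_eq.
Qed.

End Cells.

Section Coinversions.

Variables (n : nat) (S1 S2 : skew_partition) (sh N : nat).
Hypothesis le_sh1 : size (outer S1) <= sh.
Hypothesis lt_N1 : forall i, i < size (outer S1) -> part (outer S1) i.+1 + sh < N.
Hypothesis le_sh2 : size (outer S2) <= sh.

Variables (T1 : filling n S1) (T2 : filling n S2).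
Hypotheses (T1_ss : semistandard T1) (T2_ss : semistandard T2).

(** In row r+1 of the second shape, u and w are the places of path r at columns c and c+1. Reading
    missing entries as 0 and infinity turns the two inequalities into coverage of u by letters up to
    that of v and non-coverage of w by smaller ones. Triples are thus the red paths visiting column
    c. *)
Lemma count_coinversion_triple (v : seq_sub (cells S1)) i c :
    val v = (i.+1, c.+1 + i - sh) -> sh < c.+1 + i ->
  count (coinversion_triple T1 T2 v) (left_positions S2) =
  tableau_height sh T2 (T1 v).+1 c - tableau_height sh T2 (T1 v) c.+1.
Proof.
move=> vE lt_c; set e := nat_of_ord (T1 v).
rewrite count_diff => [|r cov]; last by apply: covered_left => //; apply: covered_mono.
rewrite -!sum1_count big_mkcond big_allpairs_dep [RHS]big_mkcond.
rewrite /rows (iotaDl 1 0) big_map.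
apply: eq_big_seq => r; rewrite mem_iota add0n => /andP[_ lt_r]; rewrite add1n.
have le_io := inn_le_out S2 r.
set inn := part (inner S2) r.+1 in le_io *; set out := part (outer S2) r.+1 in le_io *.
have contentE c' : (content (val v) == content (right_of (r.+1, c'))) = (c' + sh == c + r).
  by rewrite /content /right_of (congr1 fst vE) (congr1 snd vE) /=; lia.
rewrite /coinversion_triple; under eq_bigr do rewrite contentE.
have [in_range|out_range] := boolP (inn + sh <= c + r <= out + sh); last first.
  rewrite big1_seq => [|c' /andP[_]]; last first.
    by rewrite mem_iota => lt_c'; case: eqP => // eq_c'; move: out_range; lia.
  case: ifP => // /andP[cov /negP[]]; move: cov; rewrite /covered -/inn.
  case: (leqP (c + r) (inn + sh)) => [le_c|gt_c] /=; first by move: out_range; lia.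
  by move/letter_lt_cell; rewrite mem_cells /= -/inn -/out; move: out_range; lia.
pose d := c + r - sh.
have dE : d + sh = c + r by rewrite /d; lia.
rewrite (bigD1_seq d) ?iota_uniq ?mem_iota //=; last by rewrite /d; lia.
rewrite big1 ?addn0 => [|c' ne_c']; last first.
  by rewrite -dE eqn_add2r (negPf ne_c').
rewrite -dE eqxx /=.
have -> : (odflt 0 (entry T2 (r.+1, d)) <= value T1 v) = covered sh T2 e.+1 r c.
  rewrite /covered -/inn -/d /entry /letter_lt /value -/e.
  case: insubP => [x xcell _|ncell] /=.
    move: xcell; rewrite mem_cells /= => /andP[_ /andP[lt_d _]].
    by rewrite -/inn in lt_d; case: (leqP (c + r) (inn + sh)) => //; lia.
  rewrite orbF; apply/esym; move: ncell; rewrite mem_cells /= lt_r -/inn -/out; lia.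
have -> : oapp (leq (value T1 v)) true (entry T2 (right_of (r.+1, d)))
    = ~~ covered sh T2 e r c.+1.
  rewrite /covered -/inn /right_of /entry /letter_lt /value -/e /=.
  have -> : c.+1 + r - sh = d.+1 by rewrite /d; lia.
  have -> : (c.+1 + r <= inn + sh) = false by apply/negbTE; lia.
  by case: insubP => [x _ _|] //=; rewrite ltnS -leqNgt.
by case: covered => //; case: covered.
Qed.

Lemma coinvE : coinv T1 T2 = \sum_(k < n) \sum_(0 <= c < N)
  (tableau_height sh T1 k.+1 c.+1 - tableau_height sh T1 k c.+1)
   * (tableau_height sh T2 k.+1 c - tableau_height sh T2 k c.+1).
Proof.
pose D k c := tableau_height sh T2 k.+1 c - tableau_height sh T2 k c.+1.
pose G (p : position) := \sum_(k < n) letter_eq T1 p k * D k (p.2 + sh - p.1).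
transitivity (\sum_(v : seq_sub (cells S1)) G (val v)).
  apply: eq_bigr => v _; case vE : (val v) (valP v) => [i j]; rewrite mem_cells.
  case: i vE => // i vE /and3P[_ le_i /andP[lt_j le_j]].
  rewrite (@count_coinversion_triple v i (j + sh - i.+1)); last 2 first.
  - by rewrite vE; congr (_, _); lia.
  - by lia.
  rewrite /G (bigD1 (T1 v)) //= big1 => [|k ne_k]; last first.
    by rewrite -vE letter_eq_val val_eqE eq_sym (negPf ne_k).
  by rewrite -vE letter_eq_val eqxx mul1n addn0.
rewrite (sum_seq_sub S1 G) (sum_cells le_sh1 lt_N1) /G.
transitivity (\sum_(i <- iota 0 (size (outer S1))) \sum_(0 <= c < N) \sum_(k < n)
   (cell_at S1 sh i c && letter_eq T1 (i.+1, c.+1 + i - sh) k) * D k c).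
  apply: eq_big_seq => i; rewrite mem_iota => /= lt_i; apply: eq_bigr => c _.
  case cell: cell_at => /=; last by rewrite big1.
  apply: eq_bigr => k _; congr (_ * D _ _).
  by move: cell; rewrite /cell_at /=; lia.
under eq_bigr do rewrite exchange_big /=.
rewrite exchange_big; apply: eq_bigr => k _; rewrite exchange_big; apply: eq_bigr => c _ /=.
rewrite -big_distrl count_diff /=; last by move=> i; apply: covered_mono.
congr (_ * _); rewrite -sum1_count [RHS]big_mkcond; apply: eq_big_seq => i.
by rewrite mem_iota => /= lt_i; rewrite -cell_letter_eq //; case: (_ && _).
Qed.

End Coinversions.

Local Open Scope ring_scope.

(** * The LLT polynomial as a matrix entry *)

Section LLTTransfer.

Variables (n : nat) (R : comNzRingType) (t : R) (S1 S2 : skew_partition) (sh N : nat).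
Hypothesis n_gt0 : (0 < n)%N.
Hypotheses (le_sh1 : (size (outer S1) <= sh)%N) (le_sh2 : (size (outer S2) <= sh)%N).
Hypothesis lt_N1 : forall i, (i < size (outer S1))%N -> (part (outer S1) i.+1 + sh < N)%N.
Hypothesis lt_N2 : forall i, (i < size (outer S2))%N -> (part (outer S2) i.+1 + sh < N)%N.

Definition variables : seq {mpoly R[n]} := [seq 'X_i | i <- enum 'I_n].

Lemma tableau_interlaced S (T : filling n S) k c : (size (outer S) <= sh)%N ->
    semistandard T ->
  interlaced (tableau_height sh T k) (tableau_height sh T k.+1) c.
Proof.
move=> le_sh T_ss; rewrite /interlaced.
by rewrite !height_left ?height_mono ?height_up.
Qed.

Lemma monomial_chain_weight (T1 : filling n S1) (T2 : filling n S2) :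
    semistandard T1 -> semistandard T2 ->
  t ^+ coinv T1 T2 *: \prod_(i < n) 'X_i ^+ (multiplicity T1 i + multiplicity T2 i) =
  chain_weight t%:A variables (tableau_chain sh N T1) (tableau_chain sh N T2).
Proof.
move=> T1_ss T2_ss.
rewrite chain_weightE /variables size_map size_enum_ord.
transitivity (\prod_(k < n) ('X_k ^+ (multiplicity T1 k + multiplicity T2 k) *
  t%:A ^+ (\sum_(0 <= c < N) (tableau_height sh T1 k.+1 c.+1 - tableau_height sh T1 k c.+1)
   * (tableau_height sh T2 k.+1 c - tableau_height sh T2 k c.+1))%N : {mpoly R[n]})).
  rewrite big_split /= prodrXr -(coinvE le_sh1 lt_N1 le_sh2 T1_ss T2_ss).
  by rewrite -in_algE -rmorphXn /= mulrC mulr_algl.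
apply: eq_bigr => k _.
have lt_k : (k < size (enum 'I_n))%N by rewrite size_enum_ord.
rewrite (nth_map k) ?nth_ord_enum // !nth_mkseq ?ltnS ?(ltnW (ltn_ord k)) //.
have := @row_weight_heights _ (t%:A : {mpoly R[n]}) 'X_k (tableau_height sh T1 k)
  (tableau_height sh T1 k.+1) (tableau_height sh T2 k) (tableau_height sh T2 k.+1) 0 N.
rewrite !height_0 // !height_N // !ltnn => -> //; try by move=> c _; apply: tableau_interlaced.
by rewrite big_split (multiplicityE le_sh1 lt_N1) // (multiplicityE le_sh2 lt_N2).
Qed.

Lemma LLT_transfer :
  LLT n t S1 S2 = transfer t%:A variables
    (zip (partition_bits sh N (inner S1)) (partition_bits sh N (inner S2)))
    (zip (partition_bits sh N (outer S1)) (partition_bits sh N (outer S2))).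
Proof.
rewrite -sum_chain_weight; try by rewrite !size_map !size_iota.
have -> : size variables = n by rewrite size_map size_enum_ord.
rewrite -(sum_tableaux _ n_gt0 le_sh1 lt_N1); apply: eq_bigr => T1 T1_ss.
rewrite -(sum_tableaux _ n_gt0 le_sh2 lt_N2); apply: eq_bigr => T2 T2_ss.
exact: monomial_chain_weight.
Qed.

End LLTTransfer.

(** * Beads *)

Local Open Scope nat_scope.

Definition site_colors (s : seq state) : seq bool := [seq v.2 | v <- s & singleton_site v].

Definition swap_site (v : state) : state := (v.2, v.1).

Lemma recolor_colors s : recolor s (site_colors s) = s.
Proof.
elim: s => //= v s IHs; rewrite /site_colors /=.
by case: ifP => sv /=; rewrite ?sv -/(site_colors s) IHs //; case: v sv => [[] []].
Qed.

Lemma recolor_negb_colors s : recolor s (map negb (site_colors s)) = map swap_site s.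
Proof.
elim: s => //= v s IHs; rewrite /site_colors /=.
by case: ifP => sv /=; rewrite ?sv -/(site_colors s) IHs //; case: v sv => [[] []].
Qed.

Lemma site_labels_iota (b1 b2 : nat -> bool) a m :
  site_labels [seq (b1 c, b2 c) | c <- iota a m] =
  [seq count b1 (iota c.+1 (a + m - c.+1)) + count b2 (iota c.+1 (a + m - c.+1))
     | c <- iota a m & b1 c (+) b2 c].
Proof.
elim: m a => //= m IHm a; rewrite IHm addSnnS /singleton_site /=.
suff -> : sumn (map site_size [seq (b1 c, b2 c) | c <- iota a.+1 m]) =
    count b1 (iota a.+1 (a + m.+1 - a.+1)) + count b2 (iota a.+1 (a + m.+1 - a.+1)).
  by case: ifP.
rewrite -map_comp sumnE big_map /= big_split /= addnS subSS addKn.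
by congr (_ + _); rewrite -sum1_count [RHS]big_mkcond; apply: eq_bigr => c _; case: ifP.
Qed.

Section BeadRow.

Variables (sh N : nat).

Let site_column (c : nat) : int := (c%:Z - sh%:Z)%R.

Lemma partition_bitsE s : size s <= sh ->
  partition_bits sh N s = [seq site_column c \in path_columns s | c <- iota 0 N].
Proof.
move=> le_sh; apply: eq_map => c.
have -> : (partition_height sh s c.+1 < partition_height sh s c) =
    (0 < partition_height sh s c - partition_height sh s c.+1) by rewrite subn_gt0.
rewrite count_diff => [|i]; last by lia.
rewrite -has_count; apply/hasP/mapP => [[i]|[m]]; rewrite mem_iota => /= lt_i.
  by move=> eq_c; exists i.+1; rewrite ?mem_iota ?add1n //; rewrite /site_column; lia.
move=> eq_c; exists m.-1; first by rewrite mem_iota; lia.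
case: m lt_i eq_c => // m lt_m; rewrite /site_column /=; lia.
Qed.

Lemma path_columns_uniq s : is_partition s -> uniq (path_columns s).
Proof.
move=> s_part; rewrite map_inj_in_uniq ?iota_uniq // => i j; rewrite !mem_iota.
have part_dec a b : a <= b -> part s b.+1 <= part s a.+1.
  move=> le_ab; rewrite -(subnKC le_ab); elim: (b - a) => [|d IHd]; first by rewrite addn0.
  by rewrite addnS; apply: leq_trans (part_nonincreasing _ s_part) IHd.
case: i => // i _; case: j => // j _ eq_ij.
by have := part_dec i j; have := part_dec j i; lia.
Qed.

Lemma path_columns_window s x : size s <= sh ->
    (forall i, i < size s -> part s i.+1 + sh < N) ->
  x \in path_columns s -> x \in map site_column (iota 0 N).
Proof.
move=> le_sh lt_N /mapP[m]; rewrite mem_iota => /andP[m_gt0 lt_m] ->.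
have := lt_N m.-1; rewrite prednK // => /(_ _)/wrap[|lt_mN]; first by lia.
apply/mapP; exists (part s m + sh - m.-1); first by rewrite mem_iota; lia.
by rewrite /site_column; lia.
Qed.

Let bit s c := site_column c \in path_columns s.

Lemma site_column_inj : injective site_column.
Proof. by move=> c c'; rewrite /site_column; lia. Qed.

Lemma count_path_columns s c : is_partition s -> size s <= sh ->
    (forall i, i < size s -> part s i.+1 + sh < N) ->
  count (fun d => site_column c < d)%R (path_columns s) =
  count (bit s) (iota c.+1 (0 + N - c.+1)).
Proof.
move=> s_part le_sh lt_N; rewrite -!size_filter -(size_map site_column); apply: perm_size.
apply: uniq_perm; rewrite ?filter_uniq ?path_columns_uniq //.
  by rewrite (map_inj_uniq site_column_inj) filter_uniq ?iota_uniq.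
move=> x; rewrite mem_filter; apply/andP/mapP => [[lt_cx xs]|[c']].
  have /mapP[c' c'N xE] := path_columns_window le_sh lt_N xs.
  exists c' => //; rewrite mem_filter /bit -xE xs mem_iota.
  by move: c'N lt_cx; rewrite mem_iota xE /site_column; lia.
rewrite mem_filter mem_iota => /andP[c's lt_c'] ->; split=> //.
by rewrite /site_column; lia.
Qed.

Section TwoPartitions.

Variables s1 s2 : seq nat.
Hypotheses (s1_part : is_partition s1) (s2_part : is_partition s2).
Hypotheses (le_sh1 : size s1 <= sh) (le_sh2 : size s2 <= sh).
Hypothesis lt_N1 : forall i, i < size s1 -> part s1 i.+1 + sh < N.
Hypothesis lt_N2 : forall i, i < size s2 -> part s2 i.+1 + sh < N.

Let sites := zip (partition_bits sh N s1) (partition_bits sh N s2).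

Lemma sitesE : sites = [seq (bit s1 c, bit s2 c) | c <- iota 0 N].
Proof. by rewrite /sites !partition_bitsE // zip_map. Qed.

(** Both sides list the same set in strictly increasing order. A singleton occurs in just one of two
    repetition-free lists, so sorting leaves no duplicates. *)
Lemma sorted_singletons :
  sort <=%R [seq x <- path_columns s1 ++ path_columns s2
               | (x \in path_columns s1) (+) (x \in path_columns s2)] =
  map site_column [seq c <- iota 0 N | bit s1 c (+) bit s2 c].
Proof.
apply: (irr_sorted_eq lt_trans lt_irreflexive).
- rewrite sort_lt_sorted filter_cat cat_uniq !filter_uniq ?path_columns_uniq // andbT.
  apply/hasPn => x; rewrite !mem_filter => /andP[+ xs2].
  by rewrite xs2; case: (x \in path_columns s1).
- rewrite sorted_map; apply: sorted_filter; first by move=> x y z /=; apply: lt_trans.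
  apply: sub_sorted (iota_ltn_sorted 0 N) => c c' /=.
  by rewrite /site_column; lia.
move=> x; rewrite mem_sort mem_filter mem_cat; apply/andP/mapP => [[sx xs]|[c]].
  have /mapP[c cN xE] : x \in map site_column (iota 0 N).
    by case/orP: xs; apply: path_columns_window.
  by exists c; rewrite // mem_filter cN /bit -xE sx.
rewrite mem_filter => /andP[sc _] ->; split=> //.
by move: sc; rewrite /bit; case: (_ \in _) => //=.
Qed.

Lemma map_label_bead_row b : map label (bead_row b s1 s2) = site_labels sites.
Proof.
rewrite sitesE site_labels_iota /bead_row sorted_singletons -!map_comp.
by apply: eq_map => c /=; rewrite count_cat !count_path_columns.
Qed.

Lemma map_red_bead_row b : map is_red (bead_row b s1 s2) = site_colors sites.
Proof.
by rewrite sitesE /site_colors /bead_row sorted_singletons filter_map -!map_comp.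
Qed.

Lemma all_on_top_bead_row b : all (fun x => on_top x == b) (bead_row b s1 s2).
Proof. by rewrite /bead_row all_map; apply/allP => x _ /=. Qed.

Lemma sorted_column_bead_row b :
  sorted (fun x y => column x < column y)%R (bead_row b s1 s2).
Proof.
suff : sorted <%R (map column (bead_row b s1 s2)) by rewrite sorted_map.
rewrite /bead_row sorted_singletons -!map_comp sorted_map; apply: sorted_filter; first by move=> x y z /=; apply: lt_trans.
apply: sub_sorted (iota_ltn_sorted 0 N) => c c' /=.
by rewrite /site_column; lia.
Qed.

Lemma top_bead_row_ordered : pairwise bead_before (bead_row true s1 s2).
Proof.
apply: (@sub_in_pairwise _ [pred x | on_top x == true] (fun x y => column x < column y)%R)
  (all_on_top_bead_row true) _.
  by move=> x y /eqP topx _ /= lt_xy; rewrite /bead_before topx lt_xy implybT.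
rewrite -sorted_pairwise ?sorted_column_bead_row // => x y z; exact: lt_trans.
Qed.

Lemma bottom_bead_row_ordered : pairwise bead_before (rev (bead_row false s1 s2)).
Proof.
have all_bot := all_on_top_bead_row false; rewrite -all_rev in all_bot.
apply: (@sub_in_pairwise _ [pred x | on_top x == false] (fun x y => column y < column x)%R)
  all_bot _.
  by move=> x y /eqP botx /eqP boty lt_yx; rewrite /bead_before botx boty; apply: lt_yx.
rewrite -(@sorted_pairwise _ (fun x y => column y < column x)%R).
  by rewrite rev_sorted sorted_column_bead_row.
by move=> x y z lt_xy lt_yz; apply: lt_trans lt_yz lt_xy.
Qed.

End TwoPartitions.

End BeadRow.

Local Open Scope ring_scope.

Lemma sqrt_t_neq0 : sqrt_t != 0.
Proof. by rewrite /sqrt_t tofrac_eq0 polyX_eq0. Qed.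

(** Clearing denominators gives a polynomial whose value at 1 is m+1. *)
Lemma q_integer_neq0 m : \sum_(l < m.+1) (sqrt_t ^+ 2)^-1 ^+ l != 0.
Proof.
pose P : {poly int} := \sum_(l < m.+1) 'X ^+ (2 * (m - l)).
have PE : sqrt_t ^+ (2 * m) * \sum_(l < m.+1) (sqrt_t ^+ 2)^-1 ^+ l = tofrac P.
  rewrite mulr_sumr rmorph_sum; apply: eq_bigr => l _; rewrite rmorphXn /= -/sqrt_t.
  have le_lm : (l <= m)%N by rewrite -ltnS.
  rewrite -{1}(subnK le_lm) mulnDr exprD -mulrA !exprM -exprMn mulfV ?expr1n ?mulr1 //.
  by rewrite expf_neq0 ?sqrt_t_neq0.
apply: contraTneq (_ : tofrac P != 0) => [eq0|].
  by rewrite -PE eq0 mulr0 eqxx.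
rewrite tofrac_eq0; apply: contraTneq (_ : P.[1] != 0) => [->|]; first by rewrite horner0 eqxx.
rewrite horner_sum (eq_bigr (fun=> 1)) => [|l _]; last by rewrite hornerXn expr1n.
by rewrite sumr_const card_ord pnatr_eq0.
Qed.

(** * The beads of a pair of skew shapes *)

Section Beads.

Variables S1 S2 : skew_partition.

(** The shift makes every path column nonnegative, and [N] exceeds every shifted column, so one
    window of sites holds both boundaries. *)
Let sh := maxn (size (outer S1)) (size (outer S2)).
Let N := (sh + (\sum_(i < size (outer S1)) part (outer S1) i.+1
             + \sum_(i < size (outer S2)) part (outer S2) i.+1)).+1.

Lemma le_sh1 : (size (outer S1) <= sh)%N. Proof. exact: leq_maxl. Qed.
Lemma le_sh2 : (size (outer S2) <= sh)%N. Proof. exact: leq_maxr. Qed.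

Lemma lt_outer1 i : (i < size (outer S1))%N -> (part (outer S1) i.+1 + sh < N)%N.
Proof.
move=> lt_i; rewrite /N ltnS addnC leq_add2l (bigD1 (Ordinal lt_i)) //=.
by rewrite -addnA leq_addr.
Qed.

Lemma lt_outer2 i : (i < size (outer S2))%N -> (part (outer S2) i.+1 + sh < N)%N.
Proof.
move=> lt_i; rewrite /N ltnS addnC leq_add2l addnC (bigD1 (Ordinal lt_i)) //=.
by rewrite -addnA leq_addr.
Qed.

Let sites s1 s2 := zip (partition_bits sh N s1) (partition_bits sh N s2).
Let top := sites (outer S1) (outer S2).
Let bot := sites (inner S1) (inner S2).
Let bs := beads S1 S2.
Let positives : {set 'I_(size bs)} := [set x | positive (nth_bead x)].


Let x0 := Bead true true 0 0.
Let p := size (site_labels top).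
Let q := size (site_labels bot).

Lemma lt_inner1 i : (i < size (inner S1))%N -> (part (inner S1) i.+1 + sh < N)%N.
Proof.
rewrite size_inner => /lt_outer1; apply: leq_ltn_trans.
by rewrite leq_add2r inn_le_out.
Qed.

Lemma lt_inner2 i : (i < size (inner S2))%N -> (part (inner S2) i.+1 + sh < N)%N.
Proof.
rewrite size_inner => /lt_outer2; apply: leq_ltn_trans.
by rewrite leq_add2r inn_le_out.
Qed.

Let top_row := bead_row true (outer S1) (outer S2).
Let bot_row := bead_row false (inner S1) (inner S2).

Let map_label_top : map label top_row = site_labels top.
Proof.
by apply: map_label_bead_row; rewrite ?outer_partition ?le_sh1 ?le_sh2 //;
  [apply: lt_outer1 | apply: lt_outer2].
Qed.

Let map_label_bot : map label bot_row = site_labels bot.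
Proof.
by apply: map_label_bead_row; rewrite ?inner_partition ?size_inner ?le_sh1 ?le_sh2 //;
  rewrite -size_inner; [apply: lt_inner1 | apply: lt_inner2].
Qed.

Let map_red_top : map is_red top_row = site_colors top.
Proof.
by apply: map_red_bead_row; rewrite ?outer_partition ?le_sh1 ?le_sh2 //;
  [apply: lt_outer1 | apply: lt_outer2].
Qed.

Let map_red_bot : map is_red bot_row = site_colors bot.
Proof.
by apply: map_red_bead_row; rewrite ?inner_partition ?size_inner ?le_sh1 ?le_sh2 //;
  rewrite -size_inner; [apply: lt_inner1 | apply: lt_inner2].
Qed.

Let size_top_row : size top_row = p. Proof. by rewrite -(size_map label) map_label_top. Qed.
Let size_bot_row : size bot_row = q. Proof. by rewrite -(size_map label) map_label_bot. Qed.

Lemma size_beads : size bs = (p + q)%N.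
Proof. by rewrite size_cat size_rev size_top_row size_bot_row. Qed.

Lemma beads_ordered : pairwise bead_before bs.
Proof.
rewrite pairwise_cat; apply/and3P; split.
- apply: sub_all (all_on_top_bead_row (outer S1) (outer S2) true) => x /eqP x_top.
  rewrite /= all_rev; apply: sub_all (all_on_top_bead_row (inner S1) (inner S2) false) => y /eqP y_bot.
  by rewrite /bead_before x_top y_bot.
- by apply: (top_bead_row_ordered (sh := sh) (N := N)); rewrite ?outer_partition ?le_sh1 ?le_sh2 //;
    [apply: lt_outer1 | apply: lt_outer2].
by apply: (bottom_bead_row_ordered (sh := sh) (N := N));
  rewrite ?inner_partition ?size_inner ?le_sh1 ?le_sh2 //; rewrite -size_inner; [apply: lt_inner1 | apply: lt_inner2].
Qed.

Lemma nth_beadE (x : 'I_(size bs)) : nth_bead x = nth x0 bs x.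
Proof. by rewrite /nth_bead (tnth_nth x0). Qed.

Lemma label_nth_bead (x : 'I_(size bs)) : label (nth_bead x) = bead_label top bot x.
Proof.
rewrite nth_beadE /bead_label -map_label_top -map_label_bot -map_rev -map_cat.
by rewrite (nth_map x0).
Qed.

Lemma on_top_nth_bead (x : 'I_(size bs)) : on_top (nth_bead x) = (x < p)%N.
Proof.
have := ltn_ord x; rewrite [X in (_ < X)%N]size_beads nth_beadE nth_cat size_top_row => lt_x.
case: ltnP => lt_xp.
  have /(all_nthP x0)/(_ x) := all_on_top_bead_row (outer S1) (outer S2) true.
  by rewrite size_top_row => /(_ lt_xp)/eqP.
rewrite nth_rev size_bot_row; last by lia.
have /(all_nthP x0)/(_ (q - (x - p).+1)%N) := all_on_top_bead_row (inner S1) (inner S2) false.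
by rewrite size_bot_row => /(_ _)/eqP; apply; lia.
Qed.

Lemma mem_at_positives i : (i < size bs)%N -> mem_at positives i = positive (nth x0 bs i).
Proof.
by move=> lt_i; rewrite -[i in LHS]/(val (Ordinal lt_i)) mem_atE inE nth_beadE.
Qed.

Lemma top_word_positives : top_word top positives = site_colors top.
Proof.
rewrite -map_red_top; apply: (@eq_from_nth _ false).
  by rewrite size_mkseq size_map size_top_row.
rewrite size_mkseq => i lt_i; rewrite nth_mkseq // mem_at_positives ?size_beads ?ltn_addr //.
rewrite nth_cat size_top_row lt_i (nth_map x0) ?size_top_row // /positive.
have /(all_nthP x0)/(_ i) := all_on_top_bead_row (outer S1) (outer S2) true.
by rewrite size_top_row => /(_ lt_i)/eqP ->; rewrite eqb_id.
Qed.

Lemma bot_word_positives : bot_word top bot positives = site_colors bot.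
Proof.
rewrite -map_red_bot; apply: (@eq_from_nth _ false).
  by rewrite size_mkseq size_map size_bot_row.
rewrite size_mkseq -/q => j lt_j; rewrite nth_mkseq // -/p -/q.
rewrite mem_at_positives ?size_beads ?ltn_add2l; last by lia.
rewrite nth_cat size_top_row ltnNge leq_addr /= addKn nth_rev size_bot_row; last by lia.
rewrite (_ : (q - (q - j.+1).+1)%N = j); last by lia.
rewrite (nth_map x0) ?size_bot_row // /positive.
have /(all_nthP x0)/(_ j) := all_on_top_bead_row (inner S1) (inner S2) false.
by rewrite size_bot_row => /(_ lt_j)/eqP ->; rewrite eqbF_neg negbK.
Qed.

Lemma mem_at_setC (M : nat) (A : {set 'I_M}) i : (i < M)%N -> mem_at (~: A) i = ~~ mem_at A i.
Proof.
by move=> lt_i; rewrite -[i]/(val (Ordinal lt_i)) !mem_atE inE.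
Qed.

Lemma top_word_setC (A : {set 'I_(size bs)}) :
  top_word top (~: A) = map negb (top_word top A).
Proof.
rewrite /top_word /mkseq -map_comp; apply/eq_in_map => i; rewrite mem_iota => /= lt_i.
by rewrite mem_at_setC // size_beads ltn_addr.
Qed.

Lemma bot_word_setC (A : {set 'I_(size bs)}) :
  bot_word top bot (~: A) = map negb (bot_word top bot A).
Proof.
rewrite /bot_word /mkseq -map_comp; apply/eq_in_map => i; rewrite mem_iota => /= lt_i.
by rewrite mem_at_setC // size_beads ltn_add2l -/q; rewrite -/q in lt_i; lia.
Qed.

Variable n : nat.
Hypothesis n_gt0 : (0 < n)%N.

Let xs := variables n coef_field.

Lemma LLT_positives : LLT n t S1 S2 = recolored_transfer sqrt_t xs top bot positives.
Proof.
rewrite /recolored_transfer top_word_positives bot_word_positives !recolor_colors.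
exact: (LLT_transfer t n_gt0 le_sh1 le_sh2 lt_outer1 lt_outer2).
Qed.

Lemma LLT_swap_positives :
  LLT n t S2 S1 = recolored_transfer sqrt_t xs top bot (~: positives).
Proof.
have swap_zip (s s' : seq bool) : map swap_site (zip s s') = zip s' s.
  by elim: s s' => [|v s IHs] [|v' s'] //=; rewrite IHs.
rewrite /recolored_transfer top_word_setC bot_word_setC top_word_positives bot_word_positives.
rewrite !recolor_negb_colors !swap_zip.
exact: (LLT_transfer t n_gt0 le_sh2 le_sh1 lt_outer2 lt_outer1).
Qed.

Lemma LLT_swap_blocks b a k : size bs = k.*2 -> (a <= k)%N ->
    (forall x : 'I_(size bs), positive (nth_bead x) = b (+) (a <= x < a + k)%N) ->
  let E := \sum_(x < size bs) bead_charge (nth_bead x) +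
    (if b then a.*2%:Z - k%:Z else k%:Z - a.*2%:Z) in
  (exists j : int, E = 2 * j) /\ LLT n t S1 S2 = sqrt_t ^ E *: LLT n t S2 S1.
Proof.
move=> size_k le_ak sgnE E; rewrite LLT_positives LLT_swap_positives.
have eq_size : size bot = size top by rewrite !size_zip !size_map.
pose U := segment (size bs) k a.
have swapU : recolored_transfer sqrt_t xs top bot U =
    sqrt_t ^ swap_exponent top bot (size bs) k a *: recolored_transfer sqrt_t xs top bot (~: U).
  exact: (recolored_swap size_beads size_k le_ak xs sqrt_t_neq0 eq_size q_integer_neq0).
have [j evenU] := swap_exponent_even size_beads size_k le_ak.
rewrite evenU in swapU.
have chargeE : \sum_(x < size bs) bead_charge (nth_bead x) = (-1) ^+ b *
    (\sum_(x in U) site_charge top bot x - \sum_(x in ~: U) site_charge top bot x).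
  rewrite (bigID (mem U)) /= mulrBr !mulr_sumr -sumrN; congr (_ + _).
    apply: eq_bigr => x; rewrite inE => xU; rewrite /bead_charge /bead_sign sgnE xU.
    by rewrite label_nth_bead on_top_nth_bead; case: (b); rewrite ?mul1r.
  apply: eq_big => [x|x]; rewrite !inE // => xU; rewrite /bead_charge /bead_sign sgnE (negPf xU).
  by rewrite label_nth_bead on_top_nth_bead; case: (b); rewrite /= ?mul1r ?mulN1r ?opprK.
(* When [b] is true the positive beads form the complement of the segment, so the relation is read
   backwards and the exponent changes sign. *)
case: b sgnE chargeE @E => sgnE chargeE E.
  have posE : positives = ~: U.
    by apply/setP=> x; rewrite !inE sgnE addTb.
  have EE : E = 2 * (- j).
    by rewrite mulrN -evenU /E chargeE /swap_exponent; ring.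
  split; first by exists (- j).
  rewrite posE setCK swapU scalerA EE -expfzDr ?sqrt_t_neq0 //.
  by rewrite mulrN addNr expr0z scale1r.
have posE : positives = U.
  by apply/setP=> x; rewrite !inE sgnE addFb.
have EE : E = 2 * j by rewrite -evenU /E chargeE mul1r.
by split; [exists j | rewrite posE swapU EE].
Qed.

End Beads.

Theorem theorem1p1 (n : nat) (n_ge1 : (1 <= n)%N) (S1 S2 : skew_partition)
    (M : {set bead_arc (beads S1 S2)})
    (M_noncrossing : noncrossing_matching M)
    (M_unique : forall M' : {set bead_arc (beads S1 S2)},
        noncrossing_matching M' -> M' = M) :
  (exists k : int, LLT n t S1 S2 = t ^ k *: LLT n t S2 S1) /\
  LLT n t S1 S2 = (\prod_(a in M) weight sqrt_t a) *: LLT n t S2 S1.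
Proof.
have [M_matching _] := andP M_noncrossing.
have [b [a [e [le_ae sgnE]]]] := unique_two_blocks M_noncrossing M_unique.
have [k [size_k eE le_ak expE]] := blocks_exponent M_matching (beads_ordered S1 S2) le_ae sgnE.
rewrite (prod_weight _ sqrt_t_neq0) // expE.
rewrite eE in sgnE; have [[j even_j] ->] := LLT_swap_blocks n_ge1 size_k le_ak sgnE.
by split=> //; exists j; rewrite even_j -exprz_exp.
Qed.
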